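(* There exists an absolute constant $c>0$ (not depending on $n,\sigma,\boldsymbol\mu,V$) such that the following holds. Let $n\ge 2$, $\sigma>0$, and for $\boldsymbol\mu\in\mathbb{R}^n$ let $\mathbf{y}=\boldsymbol\mu+\boldsymbol\xi$ where $\boldsymbol\xi$ has distribution $\mathcal{N}(0,\sigma^2 I_{n\times n})$. Let $\hat{\boldsymbol\mu}^{Q}$ be the estimator defined in the context. Then for any $\boldsymbol\mu\in\mathcal{S}^\uparrow$, $$\mathbb{E}_{\boldsymbol\mu}\|\hat{\boldsymbol\mu}^{Q}-\boldsymbol\mu\|^2\le c\,\max\left(\left(\frac{\sigma^2V(\boldsymbol\mu)\log n}{n}\right)^{2/3},\ \frac{\sigma^2\log n}{n}\right).$$ In addition, for any $V>0$ and any $\boldsymbol\mu\in\mathbb{R}^n$, $$\mathbb{E}_{\boldsymbol\mu}\|\hat{\boldsymbol\mu}^{Q}-\boldsymbol\mu\|-\min_{\boldsymbol u\in\mathcal{S}^\uparrow(V)}\|\boldsymbol u-\boldsymbol\mu\|\le c\,\max\left(\left(\frac{\sigma^2V\log n}{n}\right)^{1/3},\ \sigma\sqrt{\frac{\log n}{n}}\right).$$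
   Context: Norm: $\|\boldsymbol u\|^2=\frac1n\sum_{i=1}^n u_i^2$ for $\boldsymbol u\in\mathbb{R}^n$ (scaled Euclidean norm). $\mathbb{E}_{\boldsymbol\mu}$ is the expectation with respect to the distribution of $\mathbf{y}=\boldsymbol\mu+\boldsymbol\xi$. $\mathcal{S}^\uparrow=\{\boldsymbol u\in\mathbb{R}^n: u_i\le u_{i+1},\ i=1,\dots,n-1\}$; for $\boldsymbol\mu\in\mathcal{S}^\uparrow$, $V(\boldsymbol\mu)=\mu_n-\mu_1$; and $\mathcal{S}^\uparrow(V)=\{\boldsymbol\mu\in\mathcal{S}^\uparrow: V(\boldsymbol\mu)\le V\}$. Estimator $\hat{\boldsymbol\mu}^{Q}$ (a function of $\mathbf{y}$, with $\sigma$ known): for every $J\subseteq\{1,\dots,n-1\}$ (including $J=\emptyset$) let $$\pi_J=\frac{\exp(-|J|)}{H\binom{n-1}{|J|}},\qquad H=\sum_{i=0}^{n-1}\exp(-i),$$ let $V_J=\{\boldsymbol u\in\mathbb{R}^n:\ u_{i+1}=u_i\ \text{for all } i\in\{1,\dots,n-1\}\setminus J\}$, and let $P_J\in\mathbb{R}^{n\times n}$ be the orthogonal projector onto $V_J$. For $\boldsymbol\theta=(\theta_J)_{J\subseteq\{1,\dots,n-1\}}$ with real entries put $\boldsymbol\mu_{\boldsymbol\theta}=\sum_{J}\theta_J P_J\mathbf{y}$. Let $\Lambda=\{\boldsymbol\theta:\ \theta_J\ge0\ \text{for all }J,\ \sum_J\theta_J=1\}$. Then $\hat{\boldsymbol\mu}^{Q}=\boldsymbol\mu_{\hat{\boldsymbol\theta}}$,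 where $\hat{\boldsymbol\theta}$ is a minimizer over $\boldsymbol\theta\in\Lambda$ of $$\|\boldsymbol\mu_{\boldsymbol\theta}-\mathbf{y}\|^2+\sum_{J\subseteq\{1,\dots,n-1\}}\theta_J\left(\frac{2\sigma^2|J|}{n}+\frac12\|\boldsymbol\mu_{\boldsymbol\theta}-P_J\mathbf{y}\|^2+\frac{46\sigma^2}{n}\log\frac1{\pi_J}\right).$$ *)

(* Defs.v *)
From HB Require Import structures.
From mathcomp Require Import all_boot all_order all_algebra.
From mathcomp Require Import all_classical all_reals all_analysis.

Set Implicit Arguments.
Unset Strict Implicit.
Unset Printing Implicit Defensive.

Import Order.TTheory GRing.Theory Num.Theory.

Local Open Scope classical_set_scope.
Local Open Scope ring_scope.

(* Conventions.  The dimension is n = N.+1 and vectors are rows 'rV[R]_N.+1.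
   The index set {1, ..., n-1} is 'I_N: the (0-based) i : 'I_N stands for the
   pair of consecutive coordinates [lo i] (value i) and [hi i] (value i + 1). *)

Definition lo (N : nat) (i : 'I_N) : 'I_N.+1 := widen_ord (leqnSn N) i.
Definition hi (N : nat) (i : 'I_N) : 'I_N.+1 := lift ord0 i.

Section Estimator.
Context {R : realType} {N : nat}.
Local Notation n := N.+1.
Implicit Types (u v y mu : 'rV[R]_n) (J : {set 'I_N})
  (theta : {set 'I_N} -> R).

Definition dotp u v : R := \sum_(i < n) u 0 i * v 0 i.

(* Not MathComp-Analysis's norm on matrices, which is the sup norm. *)
Definition snorm u : R := Num.sqrt (n%:R^-1 * \sum_(i < n) u 0 i ^+ 2).

Definition monotone_cone : set 'rV[R]_n :=
  [set u | forall i : 'I_N, u 0 (lo i) <= u 0 (hi i)].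

Definition endpoint_variation u : R := u 0 ord_max - u 0 ord0.

Definition monotone_cone_le (V : R) : set 'rV[R]_n :=
  [set u | monotone_cone u /\ endpoint_variation u <= V].

Definition prior_norm : R := \sum_(i < n) expR (- i%:R).

Definition prior J : R := expR (- #|J|%:R) / (prior_norm * 'C(N, #|J|)%:R).

Definition jump_space J : set 'rV[R]_n :=
  [set u | forall i : 'I_N, i \notin J -> u 0 (hi i) = u 0 (lo i)].

(* Matrices act on the right of row vectors. *)
Definition is_orth_projector (W : set 'rV[R]_n) (A : 'M[R]_n) : Prop :=
  forall y, W (y *m A) /\ (forall v, W v -> dotp (y - y *m A) v = 0).

(* The default value 0 is never used: see [jump_projP] and [orth_projector_uniq]. *)
Definition jump_proj J : 'M[R]_n := xget 0 (is_orth_projector (jump_space J)).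

Definition mix theta y : 'rV[R]_n :=
  \sum_(J : {set 'I_N}) theta J *: (y *m jump_proj J).

Definition simplex : set ({set 'I_N} -> R) :=
  [set theta | (forall J, 0 <= theta J) /\ \sum_(J : {set 'I_N}) theta J = 1].

Definition criterion (sigma : R) y theta : R :=
  snorm (mix theta y - y) ^+ 2 +
  \sum_(J : {set 'I_N}) theta J *
    (2 * sigma ^+ 2 * #|J|%:R / n%:R
     + 2^-1 * snorm (mix theta y - y *m jump_proj J) ^+ 2
     + 46 * sigma ^+ 2 / n%:R * ln ((prior J)^-1)).

Definition is_minimizer (sigma : R) y theta : Prop :=
  simplex theta /\
  (forall theta', simplex theta' ->
     criterion sigma y theta <= criterion sigma y theta').

(* The minimizing weights need not be unique, but the aggregate [mix theta y]
   is, since the criterion is a strictly convex function of it plus a linear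
   function of theta.  Hence this determines muQ pointwise. *)
Definition is_Qaggregate (sigma : R) (muQ : 'rV[R]_n -> 'rV[R]_n) : Prop :=
  forall y, exists2 theta, is_minimizer sigma y theta & muQ y = mix theta y.

Lemma dotpE u v : dotp u v = (u *m v^T) 0 0.
Proof. by rewrite mxE; apply: eq_bigr => i _; rewrite mxE. Qed.

Lemma dotp_eq0 u : dotp u u = 0 -> u = 0.
Proof.
move=> h; apply/rowP => i; rewrite [RHS]mxE.
have /psumr_eq0P := h => /(_ (fun i _ => sqr_ge0 (u 0 i))) /(_ i isT) /eqP.
by rewrite mulf_eq0 orbb => /eqP.
Qed.

Lemma orth_projector_uniq J A B :
  is_orth_projector (jump_space J) A -> is_orth_projector (jump_space J) B ->
  A = B.
Proof.
move=> hA hB; apply/row_matrixP => i; rewrite !rowE.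
set y := delta_mx 0 i; have [yA oA] := hA y; have [yB oB] := hB y.
have W : jump_space J (y *m A - y *m B).
  by move=> k kJ; rewrite !mxE; have:= yA k kJ; have := yB k kJ;
    rewrite !mxE => -> ->.
apply/eqP; rewrite -subr_eq0; apply/eqP; apply: dotp_eq0.
rewrite {1}(_ : y *m A - y *m B = (y - y *m B) - (y - y *m A)); last first.
  by rewrite opprB [RHS]addrC addrA subrK.
by have := oA _ W; have := oB _ W; rewrite !dotpE !(mulmxBl (y - _)) !mxE
  => -> ->; rewrite subrr.
Qed.

Lemma orth_projector_exists J :
  exists A, is_orth_projector (jump_space J) A.
Proof.
pose D : 'M[R]_(n, N) := \matrix_(k, i)
  ((i \notin J)%:R * ((k == hi i)%:R - (k == lo i)%:R)).
have sumE u (a : 'I_n) : \sum_k u 0 k * (k == a)%:R = u 0 a.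
  rewrite (bigD1 a) //= eqxx mulr1 big1 ?addr0 // => k /negbTE ->.
  by rewrite mulr0.
have DE u : jump_space J u <-> u *m D = 0.
  have uD i : (u *m D) 0 i = (i \notin J)%:R * (u 0 (hi i) - u 0 (lo i)).
    rewrite mxE -[u 0 (hi i)]sumE -[u 0 (lo i)]sumE -sumrB mulr_sumr.
    by apply: eq_bigr => k _; rewrite mxE mulrCA mulrBr.
  split=> [h|h i iJ].
    apply/rowP => i; rewrite uD [RHS]mxE.
    by case: (boolP (i \in J)) => iJ; rewrite ?mul0r //= h // subrr mulr0.
  have /eqP := uD i; rewrite h mxE iJ mul1r eq_sym subr_eq0.
  by move/eqP.
have [k [B [Bfree BD]]] : exists k (B : 'M[R]_(k, n)),
    row_free B /\ forall u, jump_space J u <-> (u <= B)%MS.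
  exists (\rank (kermx D)), (row_base (kermx D)); split.
    exact: row_base_free.
  by move=> u; rewrite DE eq_row_base; split => [/sub_kermxP|/sub_kermxP].
have BBu : B *m B^T \in unitmx.
  rewrite -row_free_unit -kermx_eq0; apply/eqP/row_matrixP => i.
  rewrite row0; set x := row i _.
  have x0 : x *m (B *m B^T) = 0 by rewrite /x -row_mul mulmx_ker row0.
  have /dotp_eq0 xB : dotp (x *m B) (x *m B) = 0.
    by rewrite dotpE trmx_mul mulmxA -(mulmxA x) x0 mul0mx mxE.
  by apply: (row_free_inj Bfree); rewrite xB mul0mx.
exists (B^T *m invmx (B *m B^T) *m B) => y; split.
  by apply/BD; rewrite mulmxA submxMl.
move=> v /BD/submxP[c ->]; rewrite dotpE trmx_mul mulmxBl -!mulmxA.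
by rewrite (mulmxA B B^T) (mulmxA (invmx _)) mulVmx // mul1mx subrr mxE.
Qed.

Lemma jump_projP J : is_orth_projector (jump_space J) (jump_proj J).
Proof. by apply: (xgetPex 0); exact: orth_projector_exists. Qed.

End Estimator.

Section Noise.
Context {R : realType} {d : measure_display} {T : measurableType d}.

Definition mutually_independent (P : probability T R) (I : finType)
    (X : I -> {RV P >-> R}) : Prop :=
  forall (K : {set I}) (A : I -> set R), (forall i, measurable (A i)) ->
    P (\bigcap_(i in [set` K]) (X i @^-1` A i)) =
    (\prod_(i in K) P (X i @^-1` A i))%E.

(* xi = (xi_i)_i has law N(0, sigma^2 Id); [normal_prob] is parameterized by
   the mean and the standard deviation. *)
Definition is_gaussian_noise (P : probability T R) (sigma : R) (N : nat)
    (xi : 'I_N.+1 -> {RV P >-> R}) : Prop :=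
  (forall i (A : set R), measurable A ->
     distribution P (xi i) A = normal_prob 0 sigma A) /\
  mutually_independent xi.

Definition observation (P : probability T R) (N : nat)
    (xi : 'I_N.+1 -> {RV P >-> R}) (mu : 'rV[R]_N.+1) (w : T) : 'rV[R]_N.+1 :=
  mu + \row_i xi i w.

End Noise.

Definition is_minimum (R : realType) (A : set R) (m : R) : Prop :=
  A m /\ lbound A m.

(* Main.v *)
Require Import Defs.
From HB Require Import structures.
From mathcomp Require Import all_boot all_order all_algebra.
From mathcomp Require Import all_classical all_reals all_analysis.
From mathcomp Require Import measurable_realfun.
From mathcomp Require Import ring lra.

Set Implicit Arguments.
Unset Strict Implicit.
Unset Printing Implicit Defensive.

Import Order.TTheory GRing.Theory Num.Theory.
Import numFieldNormedType.Exports.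

Local Open Scope classical_set_scope.
Local Open Scope ring_scope.

(** Write [n = N.+1], [|u|^2 = dotp u u], [xi] for the noise, [f J] for the
    least squares fit on [jump_space J] and
    [pen J = 2 sigma^2 #|J| + 46 sigma^2 ln (1 / prior J)].

    Oracle inequality. On the simplex, [n] times the criterion is half the square
    of the norm of the aggregate plus an affine function of the weights. The
    first-order condition of its minimizer [theta] in the direction of a vertex
    [k] therefore keeps a quadratic gain, which turns into
    [|muQ - mu|^2 <= |f k - mu|^2 + pen k
       + sum_J theta J (2 <xi, f J - f k> - |f J - f k|^2 / 2 - pen J)]
    ([Q_minimizer_oracle]). The first term on the right has the constant one,
    which the misspecified case needs.

    Noise. The vector [f J - f k] lies in [jump_space (J :|: k)], so
    [2 <xi, x> - |x|^2 / 2 <= 2 S] at [x = f J - f k], where [S] is the squared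
    norm of the projection of [xi] on a space of dimension at most
    [#|J| + #|k| + 1]; likewise [|f k - mu|^2 <= |u - mu|^2 + S] for every [u] in
    [jump_space k]. Altogether, the right-hand side is at most
    [|u - mu|^2 + pen k] plus the weighted mean of the [3 S - pen J], whatever
    the signal. By [coord_energy_laplace], the mean of
    [expR (3 S / (46 sigma^2))] is exponential in the dimension with a rate
    smaller than the one paid by [prior J]; so the exponentials of the
    [(3 S - pen J) / (46 sigma^2)] have a bounded sum in the mean, up to a factor
    [expR (#|k| + 1)]. This gives, for every [k] and every [u] in
    [jump_space k], with [snorm] the scaled norm,
    [E (snorm (muQ - mu))^2 <=
       snorm (u - mu)^2 + 500 (#|k| + 1) sigma^2 ln n / n]
    ([Qaggregate_oracle_bound]).

    Approximation. A nondecreasing [u] of total variation at most [V] is within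
    [M] of a step vector with at most [V / M] jumps
    ([monotone_step_approx]). With [A = sigma^2 ln n / n] and
    [M = max ((V A)^(1/3), sqrt A)], the cost [A (V / M + 1)] of the jumps is at
    most [2 M^2], of the order of the squared approximation error. The first
    bound is the case [u = mu]; the second one takes for [u] the projection of
    [mu] on the cone and passes from the square to the norm by Jensen's
    inequality.

    The estimator is specified pointwise, not as a measurable function. Its loss
    is dominated at each point by an explicit measurable function of the noise,
    and the integral of nonnegative functions is monotone even when they are not
    measurable ([le_integral_nonmeasurable]). *)

(** * Integrals of nonnegative functions *)

Section WeightedIntegrals.
Local Open Scope ereal_scope.
Context {R : realType}.
Import HBNNSimple.

Section OneSide.
Context d d' (T : measurableType d) (U : measurableType d')
  (m : {measure set T -> \bar R}) (h : T -> R) (X : T -> U).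
Hypotheses (mh : measurable_fun setT h) (h0 : forall x, (0 <= h x)%R)
  (mX : measurable_fun setT X).

Let mhX (g : U -> R) : measurable_fun setT g ->
  measurable_fun setT (fun x => (h x * g (X x))%:E).
Proof.
move=> mg; apply/measurable_EFinP/measurable_funM => //.
exact: measurableT_comp.
Qed.

Lemma weighted_integral_nnsfun (f : {nnsfun U >-> R}) :
  \int[m]_x (h x * f (X x))%:E =
  \sum_(r \in range f) r%:E * \int[m]_x (h x * \1_(f @^-1` [set r]) (X x))%:E.
Proof.
have ge0 r y : 0 <= (r * \1_(f @^-1` [set r]) y)%:E by exact: nnfun_muleindic_ge0.
under eq_integral do rewrite fimfunE EFinM -fsumEFin// ge0_mule_fsumr//.
rewrite ge0_integral_fsum//; last 2 first.
- move=> r; under eq_fun do rewrite -EFinM.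
  by apply: (mhX (g := fun y => r * \1_(f @^-1` [set r]) y)%R);
    apply: measurable_funM.
- by move=> r x _; rewrite mule_ge0// lee_fin.
apply: eq_fsbigr => r _.
have [r0|r0] := ltP r 0%R.
  rewrite integral0_eq ?integral0_eq ?mule0// => x _;
    by rewrite preimage_nnfun0// indic0 ?mulr0 ?mule0.
under eq_integral do rewrite -EFinM mulrCA EFinM.
rewrite ge0_integralZl_EFin//; last exact: mhX.
by move=> x _; rewrite lee_fin mulr_ge0.
Qed.

Lemma weighted_integral_approx (g : U -> \bar R) (mg : measurable_fun setT g) :
  (forall y, 0 <= g y) ->
  \int[m]_x ((h x)%:E * g (X x)) =
  limn (fun n => \int[m]_x (h x * nnsfun_approx measurableT mg n (X x))%:E).
Proof.
move=> g0; rewrite -monotone_convergence//.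
- apply: eq_integral => x _; apply/esym/cvg_lim => //.
  under eq_fun do rewrite EFinM; apply: cvgeZl => //.
  have g0' y : [set: U] y -> 0 <= g y by [].
  exact: (cvg_nnsfun_approx measurableT mg g0' (x := X x) I).
- by move=> n; exact: mhX.
- by move=> n x _; rewrite lee_fin mulr_ge0.
- move=> x _ a b ab; rewrite lee_fin ler_wpM2l//.
  exact/lefP/nd_nnsfun_approx.
Qed.

End OneSide.

(** The two sides are monotone-continuous and additive in the test function, so
    indicators suffice. This covers at once integration against a law given by a
    density, and the replacement of an indicator by a function in a product of
    independent variables. *)
Lemma weighted_integral_ext d1 d2 d' (T1 : measurableType d1)
    (T2 : measurableType d2) (U : measurableType d')
    (m1 : {measure set T1 -> \bar R}) (m2 : {measure set T2 -> \bar R})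
    (h1 : T1 -> R) (h2 : T2 -> R) (X1 : T1 -> U) (X2 : T2 -> U) :
  measurable_fun setT h1 -> (forall x, (0 <= h1 x)%R) ->
  measurable_fun setT X1 ->
  measurable_fun setT h2 -> (forall x, (0 <= h2 x)%R) ->
  measurable_fun setT X2 ->
  (forall A : set U, measurable A ->
    \int[m1]_x (h1 x * \1_A (X1 x))%:E = \int[m2]_x (h2 x * \1_A (X2 x))%:E) ->
  forall g : U -> R, measurable_fun setT g -> (forall y, (0 <= g y)%R) ->
  \int[m1]_x (h1 x * g (X1 x))%:E = \int[m2]_x (h2 x * g (X2 x))%:E.
Proof.
move=> mh1 h10 mX1 mh2 h20 mX2 h12 g mg g0.
have mg' : measurable_fun setT (EFin \o g) by exact/measurable_EFinP.
have g0' y : 0 <= (EFin \o g) y by rewrite lee_fin.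
under eq_integral do rewrite EFinM.
under [RHS]eq_integral do rewrite EFinM.
rewrite (weighted_integral_approx _ mh1 h10 mX1 mg' g0').
rewrite (weighted_integral_approx _ mh2 h20 mX2 mg' g0').
congr (limn _); apply/funext => n.
rewrite (weighted_integral_nnsfun _ mh1 h10 mX1).
rewrite (weighted_integral_nnsfun _ mh2 h20 mX2).
by apply: eq_fsbigr => r _; rewrite h12.
Qed.

End WeightedIntegrals.

(** The integral of a nonnegative function is the supremum of the integrals of
    the simple functions below it, so that monotonicity asks for no
    measurability. *)
Lemma le_integral_nonmeasurable {R : realType} d (T : measurableType d)
    (m : {measure set T -> \bar R}) (f g : T -> \bar R) :
  (forall x, 0 <= f x)%E -> (forall x, f x <= g x)%E ->
  (\int[m]_x f x <= \int[m]_x g x)%E.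
Proof.
move=> f0 fg; rewrite !ge0_integralTE//; last first.
  by move=> x; exact: le_trans (fg x).
apply: le_ereal_sup => _ [h hf <-]; exists h => // x.
exact: le_trans (hf x) (fg x).
Qed.

(** * Gaussian integrals *)

Section Gaussian.
Context {R : realType}.
Local Notation leb := (@lebesgue_measure R).
Implicit Types s t b : R.

Lemma centered_normal_pdfE s x : s != 0 ->
  normal_pdf 0 s x = normal_peak s * expR (- x ^+ 2 / (s ^+ 2 *+ 2)).
Proof. by move=> s0; rewrite normal_pdfE//= /normal_fun subr0. Qed.

Lemma normal_peakE s : 0 < s ->
  normal_peak s = s^-1 * (Num.sqrt (pi *+ 2))^-1.
Proof.
move=> s0; rewrite /normal_peak -mulrnAr (sqrtrM _ (sqr_ge0 s)) sqrtr_sqr.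
by rewrite gtr0_norm// invfM.
Qed.

(** Completing the square: the factor [expR (t * x)] shifts the mean of a centred
    normal density to [s ^+ 2 * t]. *)
Lemma normal_mgf s t : s != 0 ->
  (\int[leb]_x (normal_pdf 0 s x * expR (t * x))%:E =
   (expR (s ^+ 2 * t ^+ 2 / 2))%:E)%E.
Proof.
move=> s0.
have E x : (normal_pdf 0 s x * expR (t * x) =
    expR (s ^+ 2 * t ^+ 2 / 2) * normal_pdf (s ^+ 2 * t) s x)%R.
  rewrite centered_normal_pdfE// normal_pdfE//= /normal_fun -[LHS]mulrA -expRD mulrCA -expRD.
  by congr (_ * expR _); field.
under eq_integral do rewrite E EFinM.
rewrite ge0_integralZl_EFin ?expR_ge0//.
- by rewrite integral_normal_pdf mule1.
- by move=> x _; rewrite lee_fin normal_pdf_ge0.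
- by apply/measurable_EFinP; exact: measurable_normal_pdf.
Qed.

(** The factor [expR (b / 2 * x ^+ 2)] turns the standard normal density into the
    one of variance [1 / (1 - b)], up to the ratio of the peaks. *)
Lemma normal_quadratic_mgf b t : b < 1 ->
  (\int[leb]_x (normal_pdf 0 1 x * expR (b / 2 * x ^+ 2 + t * x))%:E =
   ((Num.sqrt (1 - b))^-1 * expR (t ^+ 2 / (2 * (1 - b))))%:E)%E.
Proof.
move=> b1; have b1' : 0 < 1 - b by rewrite subr_gt0.
set s := (Num.sqrt (1 - b))^-1.
have s0 : 0 < s by rewrite invr_gt0 sqrtr_gt0.
have s2 : s ^+ 2 = (1 - b)^-1 by rewrite exprVn sqr_sqrtr// ltW.
have b0 : 1 - b != 0 by rewrite gt_eqF.
have E x : (normal_pdf 0 1 x * expR (b / 2 * x ^+ 2 + t * x) =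
    s * (normal_pdf 0 s x * expR (t * x)))%R.
  rewrite !centered_normal_pdfE ?oner_eq0 ?gt_eqF// -[LHS]mulrA -(mulrA (normal_peak s)).
  rewrite -!expRD [RHS]mulrA; congr (_ * expR _).
    by rewrite !normal_peakE// invr1 mul1r mulrA divff ?mul1r// gt_eqF.
  by rewrite s2; field.
under eq_integral do rewrite E EFinM.
rewrite ge0_integralZl_EFin ?ltW//.
- rewrite normal_mgf ?gt_eqF// -EFinM s2; congr (_ * expR _)%:E.
  by field.
- by move=> x _; rewrite lee_fin mulr_ge0 ?normal_pdf_ge0 ?expR_ge0.
- apply/measurable_EFinP/measurable_funM; first exact: measurable_normal_pdf.
  by apply: measurableT_comp => //; exact: measurable_funM.
Qed.

End Gaussian.

(** * Independence *)

Section Independence.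
Context {R : realType} {d : measure_display} {T : measurableType d}
  (P : probability T R) (n : nat) (X : 'I_n -> {RV P >-> R}).
Hypothesis indX : mutually_independent X.

(** Independence is the case where every factor is an indicator. The indicators
    are replaced by functions one index at a time: with the other factors fixed,
    [weighted_integral_ext] applies to the remaining one. *)
Lemma independent_expectation_prod (f : 'I_n -> R -> R) (e : 'I_n -> R) :
  (forall i, measurable_fun setT (f i)) -> (forall i x, 0 <= f i x) ->
  (forall i, \int[P]_w (f i (X i w))%:E = (e i)%:E)%E ->
  (\int[P]_w (\prod_i f i (X i w))%:E = (\prod_i e i)%:E)%E.
Proof.
(* Only the first [k] factors are arbitrary; the others are indicators. *)
suff H k : (k <= n)%N -> forall (f : 'I_n -> R -> R) (e : 'I_n -> R),
  (forall i, measurable_fun setT (f i)) -> (forall i x, 0 <= f i x) ->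
  (forall i : 'I_n, (k <= i)%N -> exists2 A, measurable A & f i = \1_A) ->
  (forall i, \int[P]_w (f i (X i w))%:E = (e i)%:E)%E ->
  (\int[P]_w (\prod_i f i (X i w))%:E = (\prod_i e i)%:E)%E.
  move=> mf f0 fe; apply: (H n) => // i.
  by rewrite leqNgt ltn_ord.
elim: k => [_|k IH kn] {}f {}e mf f0 fA fe.
  have /choice[A hA] i : exists A, measurable A /\ f i = \1_A.
    by have [A mA ->] := fA i isT; exists A.
  have mA i : measurable (X i @^-1` A i).
    by rewrite -[X in measurable X]setTI; apply: measurable_funP => //; case: (hA i).
  have eA i : P (X i @^-1` A i) = (e i)%:E.
    by rewrite -fe (hA i).2 -(setIT (_ @^-1` _)) -integral_indic.
  have -> : (\prod_i e i)%:E = (\prod_(i in [set: 'I_n]%SET) P (X i @^-1` A i))%E.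
    rewrite -prodEFin; apply: eq_big => [i|i _]; first by rewrite inE.
    by rewrite eA.
  rewrite -indX; last by move=> i; case: (hA i).
  rewrite -[X in P X]setIT -integral_indic//; last first.
    by apply: fin_bigcap_measurable => //; exact: finite_finset.
  apply: eq_integral => w _; congr EFin; rewrite indicE.
  have -> : (w \in \bigcap_(i in [set` [set: 'I_n]%SET]) (X i @^-1` A i)) =
      [forall i, X i w \in A i].
    apply/idP/forallP => [/[1!inE] h i|h].
      by rewrite inE; apply: h; rewrite /= inE.
    by rewrite inE => i _; have := h i; rewrite inE.
  have [/forallP h|/forallPn[i /negbTE hi]] := boolP [forall i, X i w \in A i].
    by rewrite big1// => i _; rewrite (hA i).2 indicE (h i).
  by rewrite (bigD1 i)//= (hA i).2 indicE hi mul0r.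
pose j := Ordinal kn.
pose h w := \prod_(i | i != j) f i (X i w).
have mh : measurable_fun setT h.
  rewrite /h; under eq_fun do rewrite big_mkcond.
  apply: measurable_prod => i _ /=; case: eqP => // _.
  exact: measurableT_comp.
have h0 w : 0 <= h w by apply: prodr_ge0.
pose c := \prod_(i | i != j) e i.
have e0 i : 0 <= e i.
  by rewrite -lee_fin -fe; apply: integral_ge0 => w _; rewrite lee_fin.
have c0 : 0 <= c by apply: prodr_ge0.
transitivity (\int[P]_w (cst c w * f j (X j w))%:E)%E.
  under eq_integral do rewrite (bigD1 j)//= mulrC -/(h _).
  apply: (weighted_integral_ext (X1 := X j) (X2 := X j)) => //.
  move=> A mA.
  have mXA : measurable (X j @^-1` A).
    by rewrite -[X in measurable X]setTI; apply: measurable_funP.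
  pose f' i := if i == j then \1_A else f i.
  pose e' i := if i == j then fine (P (X j @^-1` A)) else e i.
  have f'E w : \prod_i f' i (X i w) = h w * \1_A (X j w).
    rewrite (bigD1 j)//= mulrC /f' eqxx; congr (_ * _).
    by apply: eq_bigr => i /negbTE ->.
  have e'E : \prod_i e' i = c * fine (P (X j @^-1` A)).
    rewrite (bigD1 j)//= mulrC /e' eqxx; congr (_ * _).
    by apply: eq_bigr => i /negbTE ->.
  have PA : (\int[P]_w (\1_A (X j w))%:E = P (X j @^-1` A))%E.
    by rewrite -(setIT (_ @^-1` _)) -integral_indic.
  under eq_integral do rewrite -f'E.
  rewrite (IH (ltnW kn) f' e'); first last.
  - rewrite /f' /e' => i; case: eqP => [->|_]; last exact: fe.
    by rewrite PA fineK// fin_num_measure.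
  - rewrite /f' => i ki; case: eqP => [_|/eqP ij]; first by exists A.
    by apply: fA; rewrite ltn_neqAle ki andbT eq_sym.
  - by rewrite /f' => i x; case: eqP.
  - by rewrite /f' => i; case: eqP.
  under eq_integral do rewrite EFinM.
  rewrite ge0_integralZl_EFin//.
  - by rewrite PA e'E EFinM fineK// fin_num_measure.
  - apply/measurable_EFinP.
    exact: (measurableT_comp (measurable_indic mA) (measurable_funPT (X j))).
under eq_integral do rewrite EFinM.
rewrite ge0_integralZl_EFin//.
- by rewrite fe -EFinM /c [in RHS](bigD1 j)//= mulrC.
- by move=> w _; rewrite lee_fin.
- by apply/measurable_EFinP; exact: measurableT_comp.
Qed.

End Independence.

(** * Scalar products and orthonormal families *)

Section DotProduct.
Context {R : realType} {N : nat}.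
Implicit Types (u v w x b : 'rV[R]_N.+1) (bs : seq 'rV[R]_N.+1).

Lemma dotpC u v : dotp u v = dotp v u.
Proof. by apply: eq_bigr => i _; rewrite mulrC. Qed.

Lemma dotpDl u v w : dotp (u + v) w = dotp u w + dotp v w.
Proof. by rewrite -big_split; apply: eq_bigr => i _; rewrite mxE mulrDl. Qed.

Lemma dotpZl a u w : dotp (a *: u) w = a * dotp u w.
Proof. by rewrite mulr_sumr; apply: eq_bigr => i _; rewrite mxE mulrA. Qed.

Lemma dotpDr u v w : dotp w (u + v) = dotp w u + dotp w v.
Proof. by rewrite dotpC dotpDl !(dotpC w). Qed.

Lemma dotpZr a u w : dotp w (a *: u) = a * dotp w u.
Proof. by rewrite dotpC dotpZl (dotpC w). Qed.

Lemma dotpNl u w : dotp (- u) w = - dotp u w.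
Proof. by rewrite -scaleN1r dotpZl mulN1r. Qed.

Lemma dotpNr u w : dotp w (- u) = - dotp w u.
Proof. by rewrite dotpC dotpNl (dotpC w). Qed.

Lemma dotp0l u : dotp 0 u = 0.
Proof. by rewrite -(scale0r (0 : 'rV_N.+1)) dotpZl mul0r. Qed.

Lemma dotp_suml (I : Type) (r : seq I) (F : I -> 'rV[R]_N.+1) w :
  dotp (\sum_(i <- r) F i) w = \sum_(i <- r) dotp (F i) w.
Proof.
elim: r => [|i r IH]; first by rewrite !big_nil dotp0l.
by rewrite !big_cons dotpDl IH.
Qed.

Lemma dotp_ge0 u : 0 <= dotp u u.
Proof. by apply: sumr_ge0 => i _; rewrite -expr2 sqr_ge0. Qed.

Definition dotp_linE := (dotpDl, dotpDr, dotpNl, dotpNr, dotpZl, dotpZr).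

Fixpoint orthonormal bs : Prop :=
  if bs is b :: bs' then
    [/\ dotp b b = 1, forall c, c \in bs' -> dotp c b = 0 & orthonormal bs']
  else True.

(** The squared norm of the orthogonal projection of [x] on the span of [bs],
    when [bs] is orthonormal. *)
Definition coord_energy bs x : R := \sum_(b <- bs) dotp b x ^+ 2.

Lemma coord_energy0 bs : coord_energy bs 0 = 0.
Proof. by apply: big1 => b _; rewrite dotpC dotp0l expr0n. Qed.

Lemma coord_energyD_orth bs x a b : (forall c, c \in bs -> dotp c b = 0) ->
  coord_energy bs (x + a *: b) = coord_energy bs x.
Proof.
move=> h; rewrite /coord_energy !big_seq; apply: eq_bigr => c cbs.
by rewrite !dotp_linE h// mulr0 addr0.
Qed.

End DotProduct.

(** * Exponential moments of the projected noise *)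

Section NoiseLaplace.
Context {R : realType} {d : measure_display} {T : measurableType d}
  (P : probability T R) (sigma : R) (N : nat) (xi : 'I_N.+1 -> {RV P >-> R}).
Hypotheses (s0 : 0 < sigma) (Hxi : is_gaussian_noise sigma xi).
Local Notation noise w := (\row_i xi i w : 'rV[R]_N.+1).
Local Notation leb := (@lebesgue_measure R).

Lemma measurable_dotp_noise v : measurable_fun setT (fun w => dotp v (noise w)).
Proof.
apply: measurable_sum => i; apply: measurable_funM => //.
by under eq_fun do rewrite mxE; exact: measurable_funPT.
Qed.

Lemma measurable_coord_energy_noise bs :
  measurable_fun setT (fun w => coord_energy bs (noise w)).
Proof.
apply: measurable_sum => b; apply: (measurable_funX 2%N).
exact: measurable_dotp_noise.
Qed.

Lemma noise_coordinate_integral i (g : R -> R) :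
  measurable_fun setT g -> (forall x, 0 <= g x) ->
  (\int[P]_w (g (xi i w))%:E = \int[leb]_x (normal_pdf 0 sigma x * g x)%:E)%E.
Proof.
move=> mg g0.
transitivity (\int[P]_w (cst 1 w * g (xi i w))%:E)%E.
  by apply: eq_integral => w _; rewrite mul1r.
apply: (@weighted_integral_ext R _ _ _ T _ _ P leb (cst 1)
  (normal_pdf 0 sigma) (xi i) id) => //.
- exact: measurable_normal_pdf.
- by move=> x; exact: normal_pdf_ge0.
move=> A mA; under eq_integral do rewrite mul1r.
have mXA : measurable (xi i @^-1` A).
  by rewrite -[X in measurable X]setTI; apply: measurable_funP.
transitivity (P (xi i @^-1` A)).
  by rewrite -(setIT (_ @^-1` _)) -integral_indic.
have := Hxi.1 i A mA; rewrite /distribution/= /pushforward => ->.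
rewrite /normal_prob integral_mkcond; apply: eq_integral => x _.
by rewrite patchE indicE; case: ifP => _; rewrite ?mulr1 ?mulr0.
Qed.

Lemma noise_laplace v :
  (\int[P]_w (expR (dotp v (noise w)))%:E =
   (expR (sigma ^+ 2 / 2 * dotp v v))%:E)%E.
Proof.
have := @independent_expectation_prod _ _ _ P _ xi Hxi.2
  (fun i x => expR (v 0 i * x)) (fun i => expR (sigma ^+ 2 * v 0 i ^+ 2 / 2)).
under eq_integral do rewrite -expR_sum.
rewrite -expR_sum => H.
transitivity (\int[P]_w (expR (\sum_i v 0 i * xi i w))%:E)%E.
  by apply: eq_integral => w _; congr (expR _)%:E; apply: eq_bigr => i _; rewrite mxE.
rewrite H.
- congr (expR _)%:E; rewrite mulr_sumr; apply: eq_bigr => i _.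
  by rewrite -expr2; lra.
- by move=> i; apply: measurableT_comp => //; exact: measurable_funM.
- by move=> i x; exact: expR_ge0.
- move=> i; rewrite (noise_coordinate_integral i (g := fun x => expR (v 0 i * x))).
  + by rewrite normal_mgf// gt_eqF.
  + by apply: measurableT_comp => //; exact: measurable_funM.
  + by move=> x; exact: expR_ge0.
Qed.

Lemma gaussian_tilt_tonelli (f g : T -> R) :
  measurable_fun setT f -> measurable_fun setT g ->
  (\int[P]_w \int[leb]_a (normal_pdf 0 1 a * expR (f w + g w * a))%:E =
   \int[leb]_a \int[P]_w (normal_pdf 0 1 a * expR (f w + g w * a))%:E)%E.
Proof.
move=> mf mg.
apply: (@fubini_tonelli _ _ _ _ _ P leb
  (fun z : T * R => (normal_pdf 0 1 z.2 * expR (f z.1 + g z.1 * z.2))%:E)).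
  apply/measurable_EFinP/measurable_funM.
    exact: measurableT_comp (measurable_normal_pdf _ _) measurable_snd.
  apply: measurableT_comp => //; apply: measurable_funD.
    exact: measurableT_comp mf measurable_fst.
  apply: measurable_funM; last exact: measurable_snd.
  exact: measurableT_comp mg measurable_fst.
by move=> z; rewrite lee_fin mulr_ge0 ?expR_ge0 ?normal_pdf_ge0.
Qed.

(** A chi-square moment generating function, obtained without a rotation of the
    noise. Each squared coordinate is linearized by
    [expR (z ^+ 2 / 2) = E (expR (g * z))] with [g] an auxiliary standard normal
    variable, and the two integrals are exchanged. The vector [v] is there for
    the induction: it absorbs the linear terms that the linearization
    produces. *)
Lemma coord_energy_laplace q bs v : 0 < q < 1 -> orthonormal bs ->
  (\int[P]_w (expR (q / (2 * sigma ^+ 2) * coord_energy bs (noise w)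
                    + dotp v (noise w)))%:E =
   ((Num.sqrt (1 - q))^-1 ^+ size bs *
     expR (sigma ^+ 2 / 2 * (dotp v v + q / (1 - q) * coord_energy bs v)))%:E)%E.
Proof.
move=> /andP[q0 q1]; have sN0 : sigma != 0 by rewrite gt_eqF.
have q1' : 1 - q != 0 by rewrite subr_eq0 gt_eqF.
elim: bs v => [|b bs IH] v.
  move=> _; under eq_integral do rewrite /coord_energy big_nil mulr0 add0r.
  by rewrite noise_laplace /coord_energy big_nil mulr0 addr0 expr0 mul1r.
move=> [bb bbs obs]; set C := (Num.sqrt (1 - q))^-1.
(* [r * dotp b (noise w)] is the [z] for which [z ^+ 2 / 2] is the term of [b]. *)
pose r := Num.sqrt q / sigma.
have r2 : r ^+ 2 = q / sigma ^+ 2.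
  by rewrite expr_div_n sqr_sqrtr// ltW.
clearbody r.
pose f w := q / (2 * sigma ^+ 2) * coord_energy bs (noise w) + dotp v (noise w).
pose g w := r * dotp b (noise w).
have mf : measurable_fun setT f.
  apply: measurable_funD; last exact: measurable_dotp_noise.
  by apply: measurable_funM => //; exact: measurable_coord_energy_noise.
have mg : measurable_fun setT g.
  by apply: measurable_funM => //; exact: measurable_dotp_noise.
transitivity (\int[P]_w \int[leb]_a
    (normal_pdf 0 1 a * expR (f w + g w * a))%:E)%E.
  apply: eq_integral => w _.
  transitivity ((expR (f w))%:E *
      \int[leb]_a (normal_pdf 0 1 a * expR (g w * a))%:E)%E.
    rewrite normal_mgf ?oner_eq0// -EFinM -expRD; congr (expR _)%:E.
    rewrite /f /g exprMn r2 /coord_energy big_cons.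
    by field.
  rewrite -ge0_integralZl_EFin ?expR_ge0//.
  - by apply: eq_integral => a _; rewrite -EFinM mulrCA -expRD.
  - by move=> a _; rewrite lee_fin mulr_ge0 ?normal_pdf_ge0 ?expR_ge0.
  - apply/measurable_EFinP/measurable_funM; first exact: measurable_normal_pdf.
    by apply: measurableT_comp => //; exact: measurable_funM.
rewrite gaussian_tilt_tonelli//.
pose K := C ^+ size bs * expR (sigma ^+ 2 / 2 *
    (dotp v v + q / (1 - q) * coord_energy bs v)).
transitivity (\int[leb]_a (K%:E * (normal_pdf 0 1 a *
    expR (q / 2 * a ^+ 2 + (sigma ^+ 2 * r * dotp b v) * a))%:E))%E.
  apply: eq_integral => a _.
  under eq_integral do rewrite EFinM.
  rewrite ge0_integralZl_EFin ?normal_pdf_ge0//; last first.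
    apply/measurable_EFinP/measurableT_comp => //; apply: measurable_funD => //.
    exact: measurable_funM.
  have := IH (v + (r * a) *: b) obs; rewrite coord_energyD_orth// => IHa.
  rewrite (_ : \int[P]_w _ = (C ^+ size bs * expR (sigma ^+ 2 / 2 *
     (dotp (v + (r * a) *: b) (v + (r * a) *: b) +
      q / (1 - q) * coord_energy bs v)))%:E)%E; last first.
    rewrite -IHa; apply: eq_integral => w _; congr (expR _)%:E.
    by rewrite /f /g !dotp_linE; ring.
  rewrite -!EFinM /K; congr EFin.
  rewrite (_ : sigma ^+ 2 / 2 * (_ + _) =
    sigma ^+ 2 / 2 * (dotp v v + q / (1 - q) * coord_energy bs v) +
    (q / 2 * a ^+ 2 + sigma ^+ 2 * r * dotp b v * a)).
    by rewrite [in LHS]expRD; ring.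
  rewrite !dotp_linE bb (dotpC v b).
  rewrite (_ : q / 2 * a ^+ 2 = sigma ^+ 2 * r ^+ 2 / 2 * a ^+ 2).
    by field.
  by rewrite r2; field.
rewrite ge0_integralZl_EFin//.
- rewrite normal_quadratic_mgf// -/C -EFinM /K.
  congr EFin; rewrite mulrACA (mulrC _ C) -expRD; congr (_ * expR _).
    by rewrite exprS.
  rewrite /coord_energy big_cons !exprMn r2.
  by field; rewrite q1'.
- by move=> a _; rewrite lee_fin mulr_ge0 ?normal_pdf_ge0 ?expR_ge0.
- apply/measurable_EFinP/measurable_funM; first exact: measurable_normal_pdf.
  apply: measurableT_comp => //; apply: measurable_funD; apply: measurable_funM => //.
- by rewrite /K mulr_ge0 ?expR_ge0// exprn_ge0// invr_ge0 sqrtr_ge0.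
Qed.

End NoiseLaplace.

(** * Gram-Schmidt *)

Section OrthonormalFamilies.
Context {R : realType} {N : nat}.
Implicit Types (u v w x b e : 'rV[R]_N.+1) (bs es : seq 'rV[R]_N.+1).

(** Membership of [v] in the span of the orthonormal family [bs], in the weak
    form in which it is used. *)
Definition expands bs v : Prop :=
  forall x, dotp v x = \sum_(b <- bs) dotp b v * dotp b x.

Lemma expandsD bs u v : expands bs u -> expands bs v -> expands bs (u + v).
Proof.
move=> hu hv x; rewrite dotpDl hu hv -big_split; apply: eq_bigr => b _.
by rewrite dotpDr mulrDl.
Qed.

Lemma expandsZ bs a v : expands bs v -> expands bs (a *: v).
Proof.
move=> hv x; rewrite dotpZl hv mulr_sumr; apply: eq_bigr => b _.
by rewrite dotpZr mulrA.
Qed.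

Lemma expands0 bs : expands bs 0.
Proof. by move=> x; rewrite dotp0l big1// => b _; rewrite dotpC dotp0l mul0r. Qed.

Lemma expands_sum bs (I : finType) (A : {set I}) (F : I -> 'rV[R]_N.+1) :
  (forall i, i \in A -> expands bs (F i)) -> expands bs (\sum_(i in A) F i).
Proof.
move=> h; elim/big_ind: _ => //; first exact: expands0.
by move=> u v; exact: expandsD.
Qed.

Lemma orthonormal_expands bs c : orthonormal bs -> c \in bs -> expands bs c.
Proof.
elim: bs => // b bs IH [bb bbs obs]; rewrite in_cons => /orP[/eqP ->|cbs] x.
  rewrite big_cons bb mul1r big_seq big1 ?addr0// => a abs.
  by rewrite bbs// mul0r.
by rewrite big_cons dotpC (dotpC b c) bbs// mul0r add0r dotpC IH.
Qed.

(** The list [es] may be linearly dependent: a vector whose orthogonalization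
    vanishes adds nothing to the family. *)
Lemma gram_schmidt es : exists bs,
  [/\ orthonormal bs, (size bs <= size es)%N & forall e, e \in es -> expands bs e].
Proof.
elim: es => [|e es [bs [obs szb hbs]]]; first by exists [::].
pose w := e - \sum_(b <- bs) dotp b e *: b.
have wE x : dotp w x = dotp e x - \sum_(b <- bs) dotp b e * dotp b x.
  rewrite dotpDl dotpNl dotp_suml; congr (_ - _).
  by apply: eq_bigr => b _; rewrite dotpZl.
clearbody w.
have wbs c : c \in bs -> dotp c w = 0.
  move=> cbs; rewrite dotpC wE; apply/eqP; rewrite subr_eq0; apply/eqP.
  rewrite dotpC (orthonormal_expands obs cbs).
  by apply: eq_bigr => b _; rewrite mulrC.
have wexp v : expands bs v -> dotp v w = 0.
  by move=> ->; rewrite big_seq big1// => b bbs; rewrite wbs// mulr0.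
have [w0|w0] := eqVneq w 0.
  exists bs; split=> //; first exact: leq_trans szb _.
  move=> v; rewrite in_cons => /orP[/eqP ->|/hbs//] x.
  by apply/eqP; rewrite -subr_eq0 -wE w0 dotp0l.
have ww : 0 < dotp w w.
  rewrite lt_def dotp_ge0 andbT; apply: contra w0 => /eqP.
  by move=> /dotp_eq0 ->.
pose b0 := (Num.sqrt (dotp w w))^-1 *: w.
have b0E u v : dotp b0 u * dotp b0 v = dotp w u * dotp w v / dotp w w.
  rewrite !dotpZl mulrACA -invfM -expr2 sqr_sqrtr ?ltW//.
  by rewrite mulrC.
exists (b0 :: bs); split=> //=.
- split=> //.
    have -> : dotp b0 b0 = (dotp w w)^-1 * dotp w w.
      by rewrite /b0 !dotp_linE mulrA -invfM -expr2 sqr_sqrtr// ltW.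
    by rewrite mulVf// gt_eqF.
  by move=> c cbs; rewrite /b0 dotpZr (wbs c cbs) mulr0.
- move=> v; rewrite in_cons => /orP[/eqP ->|ves] x; rewrite big_cons b0E.
    have -> : dotp w e = dotp w w.
      rewrite [RHS]wE -[LHS]subr0 dotpC; congr (_ - _).
      by rewrite big_seq big1// => b bbs; rewrite wbs// mulr0.
    by rewrite mulrAC divff ?mul1r ?gt_eqF// wE subrK.
  by rewrite dotpC (dotpC w) wexp ?mul0r ?add0r 1?dotpC; exact: hbs.
Qed.

(** Only the part of [z] in the span of [bs] is seen by [x]; coordinate by
    coordinate, this is [2 * p * q - a * q ^+ 2 <= p ^+ 2 / a]. *)
Lemma linear_sub_square_le bs x z a : 0 < a -> expands bs x ->
  2 * dotp z x - a * dotp x x <= a^-1 * coord_energy bs z.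
Proof.
move=> a0 hx; rewrite (dotpC z) !hx /coord_energy !mulr_sumr -sumrB.
apply: ler_sum => b _; rewrite -subr_ge0.
rewrite (_ : _ - _ = a^-1 * (dotp b z - a * dotp b x) ^+ 2).
  by rewrite mulr_ge0 ?sqr_ge0// invr_ge0 ltW.
by field; rewrite gt_eqF.
Qed.

End OrthonormalFamilies.

(** * Bases of the spaces of step vectors *)

Section JumpSpace.
Context {R : realType} {N : nat}.
Implicit Types (u v : 'rV[R]_N.+1) (J K : {set 'I_N}).

Lemma jump_spaceB J u v : jump_space J u -> jump_space J v -> jump_space J (u - v).
Proof. by move=> hu hv i iJ; rewrite !mxE hu// hv. Qed.

Lemma jump_spaceS J K : J \subset K -> jump_space (R := R) J `<=` jump_space K.
Proof. by move=> JK u hu i iK; apply: hu; move: iK; apply: contra; exact: (fintype.subsetP JK i). Qed.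

Let step (i : 'I_N) : 'rV[R]_N.+1 := \row_k (i < k)%:R.

(** Summation by parts: a vector is its first entry plus the sum of its
    increments before the current coordinate. *)
Lemma jump_space_steps J u : jump_space J u ->
  u = u 0 0 *: const_mx 1 + \sum_(i in J) (u 0 (hi i) - u 0 (lo i)) *: step i.
Proof.
move=> hu; apply/rowP => k; rewrite !mxE mulr1 summxE.
pose f m := u 0 (inord m).
have fk : u 0 k = f k by rewrite /f inord_val.
have f0 : u 0 0 = f 0%N by rewrite /f; congr (u 0 _); apply: val_inj; rewrite /= inordK.
transitivity (f 0%N + \sum_(i < N) (f i.+1 - f i) * (i < k)%:R).
  rewrite fk -[in LHS](subrKC (f 0%N) (f k)) -telescope_sumr//; congr (_ + _).
  rewrite big_mkord (big_ord_widen N (fun i => f i.+1 - f i)); last first.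
    by rewrite -ltnS.
  by rewrite big_mkcond; apply: eq_bigr => i _; case: ifP; rewrite ?mulr1 ?mulr0.
rewrite f0; congr (_ + _); rewrite [RHS]big_mkcond; apply: eq_bigr => i _.
have flo : f i = u 0 (lo i).
  by rewrite /f; congr (u 0 _); apply: val_inj; rewrite /= inordK// ltnS ltnW.
have fhi : f i.+1 = u 0 (hi i).
  by rewrite /f; congr (u 0 _); apply: val_inj; rewrite /= inordK// ltnS.
rewrite flo fhi; case: ifPn => iJ; first by rewrite !mxE.
by rewrite hu// subrr mul0r.
Qed.

Lemma jump_space_basis J : exists bs : seq 'rV[R]_N.+1,
  [/\ orthonormal bs, (size bs <= #|J|.+1)%N & forall u, jump_space J u -> expands bs u].
Proof.
have [bs [obs szb hbs]] := gram_schmidt (const_mx 1 :: [seq step i | i <- enum J]).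
exists bs; split=> //; first by rewrite /= size_map -cardE in szb.
move=> u /jump_space_steps ->; apply: expandsD.
  by apply/expandsZ/hbs; rewrite mem_head.
apply: expands_sum => i iJ; apply/expandsZ/hbs.
by rewrite in_cons map_f ?orbT// mem_enum.
Qed.

End JumpSpace.

(** * The minimizer of the aggregation criterion *)

Section QAggregation.
Context {R : realType} {N : nat} (I : finType).
Variables (f : I -> 'rV[R]_N.+1) (p : I -> R) (y : 'rV[R]_N.+1).
Implicit Types (theta : I -> R).

Let agg theta := \sum_i theta i *: f i.
Let sq (u : 'rV[R]_N.+1) := dotp u u.

Definition Q_objective theta :=
  sq (agg theta - y) + \sum_i theta i * (p i + 2^-1 * sq (agg theta - f i)).

Let weights theta := (forall i, 0 <= theta i) /\ \sum_i theta i = 1.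

Let dotp_agg theta u : dotp (agg theta) u = \sum_i theta i * dotp (f i) u.
Proof. by rewrite dotp_suml; apply: eq_bigr => i _; rewrite dotpZl. Qed.

(** The variance identity
    [sum_i theta i |m - f i|^2 = sum_i theta i |f i|^2 - |m|^2], for [m] the
    barycentre, uses half of the square in the fit: what remains is convex in
    [m], up to terms that are linear in the weights. *)
Lemma Q_objectiveE theta : \sum_i theta i = 1 -> Q_objective theta =
  2^-1 * sq (agg theta) - 2 * dotp (agg theta) y + sq y +
  \sum_i theta i * (p i + 2^-1 * sq (f i)).
Proof.
move=> t1; rewrite /Q_objective /sq.
have E : \sum_i theta i * (p i + 2^-1 * dotp (agg theta - f i) (agg theta - f i)) =
    \sum_i theta i * (p i + 2^-1 * dotp (f i) (f i)) -
    2^-1 * dotp (agg theta) (agg theta).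
  transitivity (\sum_i (theta i * (p i + 2^-1 * dotp (f i) (f i)) +
     (2^-1 * dotp (agg theta) (agg theta)) * theta i -
     theta i * dotp (f i) (agg theta))).
    apply: eq_bigr => i _; rewrite !dotp_linE (dotpC (agg theta) (f i)); lra.
  rewrite sumrB big_split/= -dotp_agg -mulr_sumr t1; lra.
rewrite E !dotp_linE (dotpC y (agg theta)); lra.
Qed.

(** This is the nonnegativity of the directional derivative [D] of the objective
    from [theta] towards the vertex [k], rewritten. The negative squares come
    from the strong convexity in the aggregate, and make it possible to absorb
    the linear noise terms without a loss in front of [sq (f k - mu)]. *)
Lemma Q_minimizer_oracle theta k mu : weights theta ->
  (forall theta', weights theta' -> Q_objective theta <= Q_objective theta') ->
  sq (agg theta - mu) <= sq (f k - mu) + p k +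
    \sum_i theta i * (2 * dotp (y - mu) (f i - f k) - 2^-1 * sq (f i - f k) - p i).
Proof.
move=> [t0 t1] tmin; set m := agg theta.
pose l i := p i + 2^-1 * sq (f i).
pose D := dotp m (f k - m) - 2 * dotp (f k - m) y + l k - \sum_i theta i * l i.
have D0 : 0 <= D.
  pose B := sq (f k - m).
  have B0 : 0 <= B by exact: dotp_ge0.
  (* The first-order expansion is exact up to its quadratic remainder. *)
  have step e : 0 < e -> e <= 1 -> 0 <= D + e / 2 * B.
    move=> e0 e1; pose t' i := (1 - e) * theta i + e * (i == k)%:R.
    have t'S (a : I -> R) : \sum_i t' i * a i = (1 - e) * (\sum_i theta i * a i) + e * a k.
      under eq_bigr do rewrite mulrDl -!mulrA.
      rewrite big_split/= -!mulr_sumr; congr (_ + _ * _).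
      rewrite (bigD1 k)//= eqxx mul1r big1 ?addr0// => i /negbTE ->.
      by rewrite mul0r.
    have t'1 : \sum_i t' i = 1.
      have := t'S (fun=> 1); under eq_bigr do rewrite mulr1.
      by move=> ->; under eq_bigr do rewrite mulr1; rewrite t1; lra.
    have t'm : agg t' = m + e *: (f k - m).
      rewrite /agg; under eq_bigr do rewrite scalerDl -!scalerA.
      rewrite big_split/= -!scaler_sumr -/(agg theta) -/m.
      rewrite (bigD1 k)//= eqxx scale1r big1 ?addr0; last first.
        by move=> i /negbTE ->; rewrite scale0r.
      by rewrite scalerBl scale1r scalerBr addrAC -addrA.
    have t'0 i : 0 <= t' i.
      by rewrite addr_ge0// mulr_ge0// ?subr_ge0// ltW.
    have := tmin t' (conj t'0 t'1).
    rewrite !Q_objectiveE// t'm t'S -/m => h.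
    rewrite -(ler_pM2l e0) mulr0; move: h.
    rewrite /D /B /sq !dotp_linE (dotpC (f k) m) -/(l k) -/(l _).
    by rewrite /l; lra.
  rewrite leNgt; apply/negP => Dn.
  (* The step [e = - D / (B - D)] makes [D + e / 2 * B] negative if [D] is. *)
  have BD : 0 < B - D by lra.
  have := step (- D / (B - D)).
  rewrite divr_gt0 ?oppr_gt0// ler_pdivrMr// mul1r => /(_ isT).
  have -> : - D <= B - D by lra.
  move=> /(_ isT).
  rewrite (_ : D + _ = D * (B / 2 - D) / (B - D)); last by field; rewrite gt_eqF.
  rewrite pmulr_lge0 ?invr_gt0// nmulr_rge0//; lra.
have E : \sum_i theta i * (2 * dotp (y - mu) (f i - f k) - 2^-1 * sq (f i - f k) - p i) =
    2 * dotp (y - mu) (m - f k) + dotp m (f k) - 2^-1 * sq (f k)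
    - \sum_i theta i * l i.
  transitivity (\sum_i (2 * (theta i * dotp (f i) (y - mu)) +
     theta i * dotp (f i) (f k) +
     (- 2 * dotp (y - mu) (f k) - 2^-1 * sq (f k)) * theta i - theta i * l i)).
    apply: eq_bigr => i _; rewrite /l /sq !dotp_linE.
    rewrite (dotpC (f k) (f i)) (dotpC (f i) y) (dotpC (f i) mu); lra.
  rewrite sumrB !big_split/= -!mulr_sumr -!dotp_agg -/m t1.
  rewrite !dotp_linE (dotpC m y) (dotpC m mu); lra.
rewrite E; move: D0; rewrite /D /l /sq !dotp_linE.
rewrite (dotpC y m) (dotpC mu m) (dotpC y (f k)) (dotpC mu (f k)).
lra.
Qed.

End QAggregation.

(** * The prior *)

Section Prior.
Context {R : realType} {N : nat}.
Implicit Types (J : {set 'I_N}).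
Local Notation n := (N.+1%:R : R).

Lemma prior_norm_ge1 : 1 <= prior_norm (R := R) (N := N).
Proof.
rewrite /prior_norm big_ord_recl oppr0 expR0 lerDl.
by apply: sumr_ge0 => i _; exact: expR_ge0.
Qed.

Lemma prior_norm_le : prior_norm (R := R) (N := N) <= n.
Proof.
rewrite /prior_norm -[leRHS]mulr1 -[n]/(N.+1%:R) mulr_natl -[in leRHS](card_ord N.+1).
rewrite -sumr_const; apply: ler_sum => i _.
by rewrite -[leRHS]expR0 ler_expR oppr_le0 ler0n.
Qed.

Let card_leN J : (#|J| <= N)%N.
Proof. by rewrite -[leqRHS](card_ord N) max_card. Qed.

Lemma bin_card_ge1 J : (1 <= 'C(N, #|J|)%:R :> R).
Proof. by rewrite ler1n bin_gt0. Qed.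

Lemma prior_gt0 J : 0 < prior (R := R) J.
Proof.
rewrite /prior divr_gt0 ?expR_gt0// mulr_gt0//.
  exact: lt_le_trans prior_norm_ge1.
exact: lt_le_trans (bin_card_ge1 J).
Qed.

Let priorV J : (prior (R := R) J)^-1 =
  prior_norm (R := R) (N := N) * 'C(N, #|J|)%:R * expR #|J|%:R.
Proof. by rewrite /prior invfM invrK -expRN opprK mulrC. Qed.

Lemma ln_priorV_ge0 J : 0 <= ln (prior (R := R) J)^-1.
Proof.
apply: ln_ge0; rewrite priorV.
have e1 : 1 <= expR #|J|%:R :> R by rewrite -[leLHS]expR0 ler_expR ler0n.
by rewrite !mulr_ege1// ?prior_norm_ge1 ?bin_card_ge1.
Qed.

Lemma bin_leq_exp m k : ('C(m, k) <= m ^ k)%N.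
Proof.
apply: (@leq_trans (m ^_ k)); first by rewrite -bin_ffact leq_pmulr ?fact_gt0.
elim: k => [|k IH]; first by rewrite ffactn0.
by rewrite ffactnSr expnSr leq_mul ?leq_subr.
Qed.

(** Crude bounds suffice: the normalization is at most [n], and the binomial
    coefficient at most [n ^+ #|J|]. *)
Lemma ln_priorV_le J : ln (prior (R := R) J)^-1 <=
  #|J|%:R + (#|J|.+1)%:R * ln n.
Proof.
have n0 : 0 < n by [].
have -> : #|J|%:R + (#|J|.+1)%:R * ln n = ln (n ^+ #|J|.+1 * expR #|J|%:R).
  by rewrite lnM ?posrE ?exprn_gt0 ?expR_gt0// lnXn// expRK addrC mulr_natl.
rewrite ler_ln ?posrE ?invr_gt0 ?prior_gt0 ?mulr_gt0 ?exprn_gt0 ?expR_gt0//.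
rewrite priorV ler_pM2r ?expR_gt0// exprS.
have H0 : 0 <= prior_norm (R := R) (N := N) by exact: le_trans prior_norm_ge1.
rewrite ler_pM ?prior_norm_le// -natrX ler_nat.
apply: leq_trans (bin_leq_exp _ _) _.
by case: #|J| => [|k]; rewrite ?expn0// leq_exp2r.
Qed.

(** Grouped by cardinality, the binomial coefficients cancel and a geometric
    series of ratio at most [1 / 2] remains. *)
Lemma sum_prior_exp (a : R) : 0 <= a -> 2 * a <= expR 1 ->
  \sum_(J : {set 'I_N}) prior J * a ^+ #|J| <= 2.
Proof.
move=> a0 ha.
pose r := a * expR (- 1).
have r0 : 0 <= r by rewrite mulr_ge0 ?expR_ge0.
have r2 : r <= 2^-1.
  rewrite /r expRN ler_pdivrMr ?expR_gt0//; lra.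
have geo m : \sum_(j < m) r ^+ j <= 2.
  apply: (@le_trans _ _ (2 - 2 * 2^-1 ^+ m)); last first.
    by rewrite gerBl mulr_ge0// exprn_ge0.
  elim: m => [|m IH]; first by rewrite big_ord0 expr0 mulr1 subrr.
  rewrite big_ord_recr/= exprS.
  have : r ^+ m <= 2^-1 ^+ m by rewrite lerXn2r ?nnegrE.
  lra.
apply: le_trans (geo N.+1).
have cardN J : (#|J| < N.+1)%N by rewrite ltnS.
rewrite (partition_big (fun J : {set 'I_N} => Ordinal (cardN J)) xpredT)//=.
apply: ler_sum => j _.
have j_le : (j <= N)%N by rewrite -ltnS.
have bin0 : 0 < 'C(N, j)%:R :> R by rewrite ltr0n bin_gt0.
rewrite (eq_bigl (fun J => J \in [set J : {set 'I_N} | #|J| == j]%SET)); last first.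
  by move=> J; rewrite inE -val_eqE.
apply: (@le_trans _ _ (\sum_(J in [set J : {set 'I_N} | #|J| == j]%SET)
    r ^+ j / 'C(N, j)%:R)).
  apply: ler_sum => J; rewrite inE => /eqP Jj; rewrite /prior Jj invfM /r exprMn.
  rewrite -expRM_natl mulrN1 mulrA mulrAC ler_pM2r ?invr_gt0// mulrC.
  rewrite ler_wpM2l ?exprn_ge0// ler_piMr ?expR_ge0// invf_le1 ?prior_norm_ge1//.
  exact: lt_le_trans prior_norm_ge1.
by rewrite sumr_const card_draws card_ord -[leLHS]mulr_natr divfK ?lt0r_neq0.
Qed.

End Prior.
(** * Oracle inequality for the aggregate *)

Lemma ge0_integral_affine (R : realType) d (T : measurableType d)
    (P : probability T R) (I : finType) (A : R) (k z : I -> R) (Z : I -> T -> R) :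
  0 <= A -> (forall i, 0 <= k i) -> (forall i w, 0 <= Z i w) ->
  (forall i, measurable_fun setT (Z i)) ->
  (forall i, \int[P]_w (Z i w)%:E = (z i)%:E)%E ->
  (\int[P]_w (A + \sum_i k i * Z i w)%:E = (A + \sum_i k i * z i)%:E)%E.
Proof.
move=> A0 k0 Z0 mZ IZ; under eq_integral do rewrite EFinD -sumEFin.
rewrite ge0_integralD//; last 2 first.
- by move=> w _; apply: sume_ge0 => i _; rewrite lee_fin mulr_ge0.
- apply: emeasurable_sum => i; apply/measurable_EFinP.
  exact: measurable_funM.
rewrite integral_cst//= probability_setT mule1 ge0_integral_sum//; last 2 first.
- by move=> i; apply/measurable_EFinP; exact: measurable_funM.
- by move=> i w _; rewrite lee_fin mulr_ge0.
rewrite EFinD -sumEFin; congr (_ + _)%E; apply: eq_bigr => i _.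
under eq_integral do rewrite EFinM.
rewrite ge0_integralZl_EFin// ?IZ//; first by move=> w _; rewrite lee_fin.
exact/measurable_EFinP.
Qed.

Section OracleRisk.
Context {R : realType} {d : measure_display} {T : measurableType d}
  (P : probability T R) (sigma : R) (N : nat) (xi : 'I_N.+1 -> {RV P >-> R})
  (muQ : 'rV[R]_N.+1 -> 'rV[R]_N.+1).
Hypotheses (s0 : 0 < sigma) (Hxi : is_gaussian_noise sigma xi)
  (HQ : is_Qaggregate sigma muQ).
Local Notation n := (N.+1%:R : R).
Local Notation noise w := (\row_i xi i w : 'rV[R]_N.+1).

Lemma snorm_sqr (u : 'rV[R]_N.+1) : snorm u ^+ 2 = n^-1 * dotp u u.
Proof.
rewrite /snorm sqr_sqrtr; first by congr (_ * _); apply: eq_bigr => i _; rewrite expr2.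
by rewrite mulr_ge0 ?invr_ge0// sumr_ge0// => i _; exact: sqr_ge0.
Qed.

Lemma snorm_ge0 (u : 'rV[R]_N.+1) : 0 <= snorm u.
Proof. exact: sqrtr_ge0. Qed.

Let pen (J : {set 'I_N}) : R :=
  2 * sigma ^+ 2 * #|J|%:R + 46 * sigma ^+ 2 * ln (prior J)^-1.

Lemma criterionE y theta : criterion sigma y theta =
  n^-1 * Q_objective (fun J => y *m jump_proj J) pen y theta.
Proof.
rewrite /criterion /Q_objective /= snorm_sqr mulrDr; congr (_ + _).
rewrite mulr_sumr; apply: eq_bigr => J _; rewrite snorm_sqr /pen /mix.
by field; rewrite ?natr1 ?nat1r pnatr_eq0.
Qed.

(** The noise terms of [Q_minimizer_oracle] are controlled for all [J] at once.
    With [tau = 46 * sigma ^+ 2], each of them is at most [3 S - pen J], and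
    [t <= c + expR (t - c)] applied to [t = (3 S - pen J) / tau] bounds the
    weighted mean over [J] by a plain sum of exponentials, in which
    [expR (- pen J / tau) <= prior J]. The shift [c = #|k| + 1] is of the order
    of the part of the dimension of [jump_space (J :|: k)] that is not paid for
    by [prior J]. *)
Lemma Qaggregate_deterministic (bs : {set 'I_N} -> seq 'rV[R]_N.+1)
    (k : {set 'I_N}) u mu x : jump_space k u ->
  (forall J v, jump_space J v -> expands (bs J) v) ->
  dotp (muQ (mu + x) - mu) (muQ (mu + x) - mu) <= dotp (u - mu) (u - mu) + pen k +
    46 * sigma ^+ 2 * (#|k|.+1%:R + \sum_(J : {set 'I_N})
      prior J * expR (- #|k|.+1%:R) *
      expR (3 / (46 * sigma ^+ 2) * coord_energy (bs (J :|: k)) x)).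
Proof.
move=> ku hbs; set y := mu + x.
have [theta [[t0 t1] tmin] ->] := HQ y.
pose f J := y *m jump_proj J.
have fV J : jump_space J (f J) by have [] := jump_projP J y.
have xE : y - mu = x by rewrite addrC addKr.
have objmin theta' : simplex theta' ->
    Q_objective f pen y theta <= Q_objective f pen y theta'.
  by move=> /tmin; rewrite !criterionE ler_pM2l ?invr_gt0.
have := Q_minimizer_oracle k mu (conj t0 t1) objmin.
rewrite xE => /le_trans; apply.
(* Pythagoras: [y - f k] is orthogonal to [f k - u]. *)
have hk : dotp (f k - mu) (f k - mu) =
    dotp (u - mu) (u - mu) + (2 * dotp x (f k - u) - 1 * dotp (f k - u) (f k - u)).
  have [_ /(_ _ (jump_spaceB (fV k) ku))] := jump_projP k y.
  rewrite -/(f k) -xE !dotp_linE (dotpC mu (f k)) (dotpC mu u).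
  rewrite (dotpC u (f k)); lra.
pose S J := coord_energy (bs (J :|: k)) x.
pose E J := prior J * expR (- #|k|.+1%:R) * expR (3 / (46 * sigma ^+ 2) * S J).
pose tau := 46 * sigma ^+ 2.
have tau0 : 0 < tau by rewrite mulr_gt0// exprn_gt0.
pose q := 2 * dotp x (f k - u) - 1 * dotp (f k - u) (f k - u).
have qS J : q <= S J.
  rewrite -[S J]mul1r -[X in X * _]invr1; apply: linear_sub_square_le => //.
  by apply/hbs/(jump_spaceS (finset.subsetUr J k))/jump_spaceB.
have fS J : 2 * dotp x (f J - f k) - 2^-1 * dotp (f J - f k) (f J - f k) <= 2 * S J.
  rewrite -[X in X * S J]invrK; apply: linear_sub_square_le => //.
  by apply/hbs/jump_spaceB; [apply: (jump_spaceS (finset.subsetUl J k))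
    |apply: (jump_spaceS (finset.subsetUr J k))].
have EJ J : 3 * S J - pen J <= tau * (#|k|.+1%:R + E J).
  pose t := (3 * S J - pen J) / tau.
  have -> : 3 * S J - pen J = tau * t by rewrite /t [RHS]mulrC divfK// gt_eqF.
  rewrite ler_pM2l// -lerBlDl.
  apply: (@le_trans _ _ (expR (t - #|k|.+1%:R))).
    by apply: le_trans (expR_ge1Dx _); rewrite lerDr.
  rewrite /E -[prior J]lnK ?posrE ?prior_gt0// -!expRD ler_expR.
  have -> : ln (prior J : R) = - ln (prior J : R)^-1.
    by rewrite [in RHS]lnV ?opprK// posrE prior_gt0.
  have -> : t = 3 / tau * S J - 2 / 46 * #|J|%:R - ln (prior J)^-1.
    by rewrite /t /pen /tau; field; rewrite gt_eqF.
  have : 0 <= #|J|%:R :> R by [].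
  by rewrite /tau; lra.
have E0 J : 0 <= E J by rewrite /E mulr_ge0 ?expR_ge0// mulr_ge0 ?expR_ge0// ltW// prior_gt0.
have t_le1 J : theta J <= 1.
  by rewrite -t1 (bigD1 J)//= lerDl sumr_ge0.
rewrite hk -/q.
suff : q + \sum_J theta J * (2 * dotp x (f J - f k) -
    2^-1 * dotp (f J - f k) (f J - f k) - pen J) <=
    tau * (#|k|.+1%:R + \sum_J E J).
  by rewrite -/tau -/(f k); lra.
have -> : q = \sum_J theta J * q by rewrite -mulr_suml t1 mul1r.
rewrite -big_split/=.
apply: (@le_trans _ _ (\sum_J theta J * (tau * (#|k|.+1%:R + E J)))).
  apply: ler_sum => J _; rewrite -mulrDr ler_wpM2l//.
  apply: le_trans (EJ J); have := qS J; have := fS J; lra.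
rewrite (eq_bigr (fun J => tau * (theta J * #|k|.+1%:R + theta J * E J))); last first.
  by move=> J _; rewrite mulrCA mulrDr.
rewrite -mulr_sumr ler_pM2l// big_split/= -mulr_suml t1 mul1r lerD2l.
by apply: ler_sum => J _; rewrite ler_piMl.
Qed.

(** The dominating function [G] is given instead of the risk itself, for it is
    measurable and can be integrated again after other operations. *)
Lemma Qaggregate_oracle_bound (k : {set 'I_N}) (u mu : 'rV[R]_N.+1) :
  (1 <= N)%N -> jump_space k u ->
  exists G : T -> R, [/\ measurable_fun setT G,
    forall w, snorm (muQ (observation xi mu w) - mu) ^+ 2 <= G w &
    (\int[P]_w (G w)%:E <= (snorm (u - mu) ^+ 2 +
      500 * (#|k|.+1%:R * (sigma ^+ 2 * ln n / n)))%:E)%E].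
Proof.
move=> N1 ku; have n0 : 0 < n by [].
have /choice[bs hbs] := @jump_space_basis R N.
pose tau := 46 * sigma ^+ 2.
have tau0 : 0 < tau by rewrite mulr_gt0// exprn_gt0.
pose c : R := #|k|.+1%:R.
pose Z (J : {set 'I_N}) w := expR (3 / tau * coord_energy (bs (J :|: k)) (noise w)).
pose kap (J : {set 'I_N}) := n^-1 * tau * (prior J * expR (- c)).
pose A := n^-1 * (dotp (u - mu) (u - mu) + pen k + tau * c).
have pen0 : 0 <= pen k.
  rewrite /pen addr_ge0// mulr_ge0 ?ln_priorV_ge0// mulr_ge0// ?sqr_ge0//.
have A0 : 0 <= A.
  rewrite mulr_ge0 ?invr_ge0// addr_ge0//; first by rewrite addr_ge0 ?dotp_ge0.
  by rewrite mulr_ge0// ltW.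
have kap0 J : 0 <= kap J.
  rewrite /kap mulr_ge0//; first by rewrite mulr_ge0 ?invr_ge0// ltW.
  by rewrite mulr_ge0 ?expR_ge0// ltW// prior_gt0.
have Z0 J w : 0 <= Z J w by exact: expR_ge0.
have mZ J : measurable_fun setT (Z J).
  apply: measurableT_comp => //; apply: measurable_funM => //.
  exact: measurable_coord_energy_noise.
(* [q / (2 * sigma ^+ 2) = 3 / tau] at [q = 3 / 23]. *)
pose s : R := Num.sqrt (1 - 3 / 23).
have s_gt0 : 0 < s by rewrite sqrtr_gt0; lra.
have s_sqr : s ^+ 2 = 20 / 23 by rewrite /s sqr_sqrtr ?subr_ge0; [field|lra].
pose C : R := s^-1.
have IZ J : (\int[P]_w (Z J w)%:E = (C ^+ size (bs (J :|: k)))%:E)%E.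
  have q01 : 0 < (3 / 23 : R) < 1 by apply/andP; split; lra.
  have [obs _ _] := hbs (J :|: k).
  have := coord_energy_laplace s0 Hxi 0 q01 obs.
  rewrite coord_energy0 dotp0l mulr0 addr0 mulr0 expR0 mulr1 => <-.
  apply: eq_integral => w _.
  rewrite dotp0l addr0 /Z (_ : 3 / 23 / (2 * sigma ^+ 2) = 3 / tau)//.
  by rewrite /tau; field; rewrite gt_eqF.
exists (fun w => A + \sum_J kap J * Z J w); split.
- apply: measurable_funD => //; apply: measurable_sum => J.
  exact: measurable_funM.
- move=> w; rewrite /observation snorm_sqr.
  have h J v : jump_space J v -> expands (bs J) v by have [_ _] := hbs J; apply.
  pose B := \sum_J prior J * expR (- c) * Z J w.
  have -> : A + \sum_J kap J * Z J w =
      n^-1 * (dotp (u - mu) (u - mu) + pen k + tau * (c + B)).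
    have -> : \sum_J kap J * Z J w = n^-1 * tau * B.
      by rewrite /B mulr_sumr; apply: eq_bigr => J _; rewrite /kap -mulrA.
    by rewrite /A -mulrA -mulrDr -addrA -mulrDr.
  by rewrite ler_pM2l ?invr_gt0//; exact: (Qaggregate_deterministic mu (noise w) ku h).
rewrite (ge0_integral_affine A0 kap0 Z0 mZ IZ) lee_fin.
have C1 : 1 <= C by rewrite /C invf_ge1//; nra.
have C0 : 0 <= C by exact: le_trans C1.
have Ce : 2 * C <= expR 1.
  have e2 : 3 / 2 <= expR (1 / 2) :> R by apply: le_trans (expR_ge1Dx _); lra.
  have -> : expR 1 = expR (1 / 2) ^+ 2 :> R by rewrite -expRM_natl; congr expR; field.
  apply: (@le_trans _ _ ((3 / 2) ^+ 2)); last by rewrite lerXn2r// nnegrE ?expR_ge0; lra.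
  by rewrite /C ler_pdivrMr//; nra.
have sumle : \sum_J kap J * C ^+ size (bs (J :|: k)) <= n^-1 * tau * 2.
  apply: (@le_trans _ _ (\sum_J n^-1 * tau * (prior J * C ^+ #|J|))).
    apply: ler_sum => J _; rewrite /kap -mulrA ler_wpM2l//.
      by rewrite mulr_ge0 ?invr_ge0// ltW.
    rewrite -mulrA ler_wpM2l ?(ltW (prior_gt0 _))// expRN mulrC ler_pdivrMr ?expR_gt0//.
    have [_ szJ _] := hbs (J :|: k).
    apply: (@le_trans _ _ (C ^+ (#|J| + #|k|.+1))).
      apply: ler_weXn2l => //; apply: leq_trans szJ _.
      by rewrite addnS ltnS cardsU leq_subr.
    rewrite exprD ler_wpM2l ?exprn_ge0// /c -[X in expR X]mulr1 expRM_natl.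
    by rewrite lerXn2r// ?nnegrE ?expR_ge0//; lra.
  rewrite -mulr_sumr ler_wpM2l//.
    by rewrite mulr_ge0 ?invr_ge0// ltW.
  by apply: sum_prior_exp => //; exact: le_trans C1.
have L : 2^-1 <= ln n.
  rewrite -ler_expR lnK ?posrE//; apply: (@le_trans _ _ 2); last by rewrite ler_nat.
  rewrite -[2^-1 in X in expR X]opprK expRN invf_ple ?posrE ?expR_gt0//.
  by apply: le_trans (expR_ge1Dx _); lra.
apply: (@le_trans _ _ (A + n^-1 * tau * 2)); first by rewrite lerD2l.
rewrite /A snorm_sqr -mulrA -mulrDr -addrA -addrA [leLHS]mulrDr lerD2l.
rewrite (_ : 500 * _ = n^-1 * (500 * (c * (sigma ^+ 2 * ln n)))); last first.
  by rewrite /c; field; rewrite ?natr1 ?nat1r pnatr_eq0.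
rewrite ler_wpM2l ?invr_ge0// /pen /tau.
have kc : #|k|%:R = c - 1 by rewrite /c -natr1 addrK.
have c1 : 1 <= c by rewrite ler1n.
have := ln_priorV_le (R := R) k; rewrite kc -/c => hl.
have ss : 0 < sigma ^+ 2 by rewrite exprn_gt0.
have cL : c <= 2 * (c * ln n) by nra.
have -> : 500 * (c * (sigma ^+ 2 * ln n)) = sigma ^+ 2 * (500 * (c * ln n)) by ring.
apply: (@le_trans _ _ (sigma ^+ 2 *
    (2 * (c - 1) + 46 * ln (prior k)^-1 + 46 * c + 92))).
  by rewrite le_eqVlt; apply/orP; left; apply/eqP; ring.
by rewrite ler_pM2l//; lra.
Qed.

End OracleRisk.

(** * The scaled norm *)

Section ScaledNorm.
Context {R : realType} {N : nat}.
Local Notation n := (N.+1%:R : R).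
Implicit Types (u v w : 'rV[R]_N.+1).

(** Expanding [0 <= |dotp v v *: u - dotp u v *: v|^2]. *)
Lemma cauchy_schwarz u v : dotp u v ^+ 2 <= dotp u u * dotp v v.
Proof.
have := dotp_ge0 (dotp v v *: u - dotp u v *: v).
rewrite !dotp_linE (dotpC v u) => h.
have [v0|v0] := eqVneq (dotp v v) 0.
  by rewrite (dotp_eq0 v0) dotpC !dotp0l expr0n mulr0.
have vp : 0 < dotp v v by rewrite lt_def v0 dotp_ge0.
rewrite -(ler_pM2l vp); lra.
Qed.

Lemma snormD u v : snorm (u + v) <= snorm u + snorm v.
Proof.
have n0 : 0 < n^-1 by rewrite invr_gt0.
rewrite -ler_sqr ?nnegrE ?addr_ge0 ?snorm_ge0// sqrrD !snorm_sqr.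
rewrite !dotp_linE (dotpC v u).
suff : n^-1 * dotp u v <= snorm u * snorm v.
  by move: (n^-1) => k; rewrite mulr2n; lra.
rewrite (le_trans (ler_norm _))// -ler_sqr ?nnegrE ?mulr_ge0 ?snorm_ge0//.
rewrite real_normK ?num_real// !exprMn !snorm_sqr [leRHS]mulrACA -[n^-1 * n^-1]expr2.
by rewrite ler_pM2l ?exprn_gt0// cauchy_schwarz.
Qed.

Lemma snorm_le_sup u t : 0 <= t -> (forall i, `|u 0 i| <= t) -> snorm u <= t.
Proof.
move=> t0 h; rewrite -ler_sqr ?nnegrE ?snorm_ge0// snorm_sqr ler_pdivrMl//.
rewrite mulr_natl -[in leRHS](card_ord N.+1) -sumr_const; apply: ler_sum => i _.
by rewrite -expr2 -[leLHS]real_normK ?num_real// ler_sqr ?nnegrE.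
Qed.

Lemma coord_le_snorm u i : `|u 0 i| <= n * snorm u.
Proof.
have n1 : 1 <= n by rewrite ler1n.
have n0 : 0 < n by [].
rewrite -ler_sqr ?nnegrE ?mulr_ge0 ?snorm_ge0// real_normK ?num_real//.
rewrite exprMn snorm_sqr expr2 -mulrA (mulrA n n^-1) divff ?gt_eqF// mul1r.
apply: (@le_trans _ _ (dotp u u)).
  by rewrite /dotp (bigD1 i)//= -expr2 lerDl sumr_ge0// => j _; rewrite -expr2 sqr_ge0.
by rewrite ler_peMl ?dotp_ge0.
Qed.

End ScaledNorm.

(** * Approximation of monotone vectors by step vectors *)

Section StepApproximation.
Context {R : realType} {N : nat}.
Implicit Types (u v : 'rV[R]_N.+1).

Lemma sum_increments u : \sum_(i < N) (u 0 (hi i) - u 0 (lo i)) = endpoint_variation u.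
Proof.
pose f m := u 0 (inord m).
have -> : endpoint_variation u = f N - f 0%N.
  rewrite /endpoint_variation /f; congr (u 0 _ - u 0 _); apply: val_inj;
  by rewrite /= inordK.
rewrite -telescope_sumr// big_mkord; apply: eq_bigr => i _.
rewrite /f; congr (u 0 _ - u 0 _); apply: val_inj.
  by rewrite /= inordK// ltnS.
by rewrite /= inordK// ltnS ltnW.
Qed.

Lemma monotone_cone_ge_first u : monotone_cone u -> forall k, u 0 0 <= u 0 k.
Proof.
move=> hu k; suff H m : (m <= N)%N -> u 0 0 <= u 0 (inord m).
  by have := H k; rewrite inord_val -ltnS; apply.
elim: m => [|m IH] mN.
  by rewrite (_ : inord 0 = 0)//; apply: val_inj; rewrite /= inordK.
apply: le_trans (IH (ltnW mN)) _; have := hu (Ordinal mN).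
rewrite (_ : lo _ = inord m); last by apply: val_inj; rewrite /= inordK// ltnS ltnW.
by rewrite (_ : hi _ = inord m.+1)//; apply: val_inj; rewrite /= inordK.
Qed.

(** Rounding the values down to a grid of mesh [t] keeps the sequence monotone,
    and each jump of the rounded sequence costs at least [t] of its total
    variation. *)
Lemma monotone_step_approx u t : monotone_cone u -> 0 < t ->
  exists (J : {set 'I_N}) v, [/\ jump_space J v,
    #|J|%:R * t <= endpoint_variation u & snorm (v - u) <= t].
Proof.
move=> hu t0; pose g k := Num.truncn ((u 0 k - u 0 0) / t).
pose J := [set i : 'I_N | g (hi i) != g (lo i)]%SET.
pose v : 'rV[R]_N.+1 := \row_k (u 0 0 + t * (g k)%:R).
have gE k : (g k)%:R <= (u 0 k - u 0 0) / t < (g k).+1%:R.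
  apply: truncn_itv; rewrite divr_ge0 ?(ltW t0)// subr_ge0.
  exact: monotone_cone_ge_first.
have gle i : (g (lo i) <= g (hi i))%N.
  by apply: le_truncn; rewrite ler_pM2r ?invr_gt0// lerD2r.
exists J, v; split.
- by move=> i; rewrite inE negbK !mxE => /eqP ->.
- apply: (@le_trans _ _ (t * (g ord_max)%:R)); last first.
    have /andP[+ _] := gE ord_max; rewrite ler_pdivlMr// mulrC.
    by rewrite /endpoint_variation (_ : ord0 = 0).
  rewrite mulrC ler_pM2l//.
  have g0 : g 0 = 0%N by rewrite /g subrr mul0r truncn0.
  have := sum_increments (\row_k (g k)%:R : 'rV[R]_N.+1).
  rewrite /endpoint_variation !mxE (_ : ord0 = 0)// g0 subr0 => <-.
  rewrite -sum1_card natr_sum big_mkcond; apply: ler_sum => i _.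
  rewrite inE !mxE; case: ifPn => [ij|_]; last by rewrite subr_ge0 ler_nat.
  by rewrite lerBrDl natr1 ler_nat ltn_neqAle eq_sym ij gle.
- apply: snorm_le_sup; first exact: ltW.
  move=> k; rewrite !mxE.
  have /andP[] := gE k; rewrite ler_pdivlMr// ltr_pdivrMr// -natr1 mulrDl mul1r => h1 h2.
  rewrite ler_norml; apply/andP; split; lra.
Qed.

End StepApproximation.

(** * Projection on the bounded monotone cone *)

Section Projection.
Context {R : realType} {N : nat}.
Implicit Types (u v : 'rV[R]_N.+1).

Let coordc (i : 'I_N.+1) : continuous (fun u : 'rV[R]_N.+1 => u 0 i : R).
Proof. exact: coord_continuous. Qed.

Lemma closed_coord_sub (i j : 'I_N.+1) (c : R) :
  closed [set u : 'rV[R]_N.+1 | u 0 i - u 0 j <= c].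
Proof.
rewrite (_ : mkset _ = (fun u : 'rV[R]_N.+1 => u 0 i - u 0 j : R) @^-1` [set x | x <= c])//.
apply: preimage_closed; last exact: closed_le.
move=> u _; apply: (@continuousB _ R^o); exact: coordc.
Qed.

Lemma monotone_cone_le_closed (V : R) : closed (monotone_cone_le (N := N) V).
Proof.
rewrite (_ : monotone_cone_le V =
  (\bigcap_(i in [set: 'I_N]) [set u : 'rV[R]_N.+1 | u 0 (lo i) - u 0 (hi i) <= 0])
  `&` [set u | u 0 ord_max - u 0 ord0 <= V]).
  apply: closedI; last exact: closed_coord_sub.
  by apply: closed_bigI => i _; exact: closed_coord_sub.
apply/seteqP; split=> [u [h1 h2]|u [h1 h2]]; split=> //.
  by move=> i _ /=; rewrite subr_le0; exact: h1.
by move=> i; have := h1 i I; rewrite /= subr_le0.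
Qed.

Lemma snorm_sub_continuous (mu : 'rV[R]_N.+1) : continuous (fun u => snorm (u - mu)).
Proof.
have cF : continuous (fun u : 'rV[R]_N.+1 => \sum_i (u - mu) 0 i ^+ 2 : R).
  apply: (continuous_big (op := +%R)); first exact: add_continuous.
  move=> i _; under eq_fun do rewrite !mxE.
  move=> u; apply: (continuous_comp (f := fun u : 'rV[R]_N.+1 => u 0 i - mu 0 i : R)
    (g := fun x : R => x ^+ 2)); last exact: exprn_continuous.
  by apply: (@continuousB _ R^o); [exact: coordc|exact: cst_continuous].
move=> u; apply: (continuous_comp (f := fun u : 'rV[R]_N.+1 =>
  N.+1%:R^-1 * \sum_i (u - mu) 0 i ^+ 2 : R)); last exact: sqrt_continuous.
by apply: continuousM; [exact: cst_continuous|exact: cF].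
Qed.

(** The cone is unbounded, but the competitors at least as good as [0] stay in a
    box, by [coord_le_snorm]. *)
Lemma monotone_projection_exists (V : R) (mu : 'rV[R]_N.+1) : 0 < V ->
  exists2 u, monotone_cone_le V u &
    is_minimum [set snorm (u - mu) | u in monotone_cone_le V] (snorm (u - mu)).
Proof.
move=> V0; set S := monotone_cone_le V.
pose B := N.+1%:R * snorm (0 - mu).
pose K := [set u : 'rV[R]_N.+1 | forall i, `[mu 0 i - B, mu 0 i + B]%classic (u 0 i)].
have cK : compact K.
  by apply: (@rV_compact R _ (fun i => `[mu 0 i - B, mu 0 i + B]%classic)) => i;
    exact: segment_compact.
have cKS : compact (K `&` S) by apply: compact_closedI => //; exact: monotone_cone_le_closed.
have inK u : snorm (u - mu) <= snorm (0 - mu) -> K u.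
  move=> h i; have := coord_le_snorm (u - mu) i.
  have : N.+1%:R * snorm (u - mu) <= B by rewrite ler_pM2l.
  move=> /[swap] /le_trans /[apply]; rewrite !mxE ler_norml => /andP[h1 h2].
  by rewrite /= in_itv/=; apply/andP; split; lra.
have S0 : S 0.
  split; first by move=> i; rewrite !mxE.
  by rewrite /endpoint_variation !mxE subrr ltW.
have [||u] := @EVT_min_rV R _ (fun u => snorm (u - mu)) (K `&` S) _ cKS.
- by exists 0; split => //; exact: inK.
- by apply: continuous_subspaceT; exact: snorm_sub_continuous.
rewrite inE => -[Ku Su] umin; exists u => //; split; first by exists u.
move=> _ [v Sv <-].
have [h|h] := leP (snorm (v - mu)) (snorm (0 - mu)).
  by apply: umin; rewrite inE; split => //; exact: inK.
apply: le_trans (ltW h); apply: umin; rewrite inE; split=> //.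
exact: inK.
Qed.

End Projection.

(** * Risk bounds *)

(** Jensen's inequality for the square root, through
    [2 * X <= X ^+ 2 / a + a] at [a = b + r], where
    [b ^+ 2 + r ^+ 2 <= a ^+ 2]. *)
Lemma expectation_le_of_square (R : realType) d (T : measurableType d)
    (P : probability T R) (X G : T -> R) (b r : R) :
  (forall w, 0 <= X w) -> measurable_fun setT G -> (forall w, X w ^+ 2 <= G w) ->
  (\int[P]_w (G w)%:E <= (b ^+ 2 + r ^+ 2)%:E)%E -> 0 <= b -> 0 < r ->
  ('E_P[X] <= (b + r)%:E)%E.
Proof.
move=> X0 mG XG IG b0 r0; rewrite unlock; set a := b + r.
have a0 : 0 < a by rewrite ltr_wpDl.
have G0 w : 0 <= G w by apply: le_trans (XG w); exact: sqr_ge0.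
apply: (@le_trans _ _ (\int[P]_w ((a / 2)%:E + ((2 * a)^-1)%:E * (G w)%:E))%E).
  apply: le_integral_nonmeasurable => w; first by rewrite lee_fin.
  rewrite -EFinM -EFinD lee_fin.
  apply: (@le_trans _ _ (a / 2 + (2 * a)^-1 * X w ^+ 2)); last first.
    by rewrite lerD2l ler_pM2l// invr_gt0 mulr_gt0.
  rewrite -subr_ge0 (_ : _ - _ = (2 * a)^-1 * (X w - a) ^+ 2).
    by rewrite mulr_ge0 ?sqr_ge0// invr_ge0 mulr_ge0// ltW.
  by field; rewrite gt_eqF.
rewrite ge0_integralD//; last 3 first.
- by move=> w _; rewrite lee_fin divr_ge0// ltW.
- by move=> w _; rewrite -EFinM lee_fin mulr_ge0// invr_ge0 mulr_ge0// ltW.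
- by apply: measurable_funeM; exact/measurable_EFinP.
rewrite integral_cst//= probability_setT mule1 ge0_integralZl_EFin//; last 3 first.
- by move=> w _; rewrite lee_fin.
- exact/measurable_EFinP.
- by rewrite invr_ge0 mulr_ge0// ltW.
apply: (@le_trans _ _ ((a / 2)%:E + ((2 * a)^-1)%:E * (b ^+ 2 + r ^+ 2)%:E)%E).
  by rewrite leeD2l// lee_wpmul2l// lee_fin invr_ge0 mulr_ge0// ltW.
rewrite -EFinM -EFinD lee_fin -lerBrDl ler_pdivrMl ?mulr_gt0//.
by rewrite /a; nra.
Qed.

Section MonotoneRisk.
Context {R : realType} {d : measure_display} {T : measurableType d}
  (P : probability T R) (sigma : R) (N : nat) (xi : 'I_N.+1 -> {RV P >-> R})
  (muQ : 'rV[R]_N.+1 -> 'rV[R]_N.+1).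
Hypotheses (s0 : 0 < sigma) (Hxi : is_gaussian_noise sigma xi)
  (HQ : is_Qaggregate sigma muQ).
Local Notation n := (N.+1%:R : R).
Local Notation A := (sigma ^+ 2 * ln n / n).

(** The constraints on the mesh [M] make the cost [A * (V / M + 1)] of the at most
    [V / M] jumps comparable to [M ^+ 2], the square of the approximation
    error. *)
Lemma monotone_oracle_bound (V M : R) (u mu : 'rV[R]_N.+1) :
  (1 <= N)%N -> monotone_cone u -> endpoint_variation u <= V ->
  0 < M -> V * A <= M ^+ 3 -> A <= M ^+ 2 ->
  exists v (G : T -> R), [/\ snorm (v - u) <= M, measurable_fun setT G,
    forall w, snorm (muQ (observation xi mu w) - mu) ^+ 2 <= G w &
    (\int[P]_w (G w)%:E <= (snorm (v - mu) ^+ 2 + 1000 * M ^+ 2)%:E)%E].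
Proof.
move=> N1 hu uV M0 VA AM.
have [J [v [Jv JM vu]]] := monotone_step_approx hu M0.
have [G [mG hG IG]] := Qaggregate_oracle_bound s0 Hxi HQ mu N1 Jv.
exists v, G; split=> //; apply: le_trans IG _; rewrite lee_fin lerD2l.
have A0 : 0 <= A.
  by rewrite mulr_ge0 ?invr_ge0// mulr_ge0 ?sqr_ge0// ln_ge0// ler1n.
move: A0 VA AM; set a := A => A0 VA AM.
have JA : #|J|%:R * a <= M ^+ 2.
  rewrite -(ler_pM2r M0) mulrAC -exprSr; apply: le_trans VA.
  by rewrite ler_wpM2r//; exact: le_trans uV.
by rewrite -natr1 mulrDl mul1r; lra.
Qed.

End MonotoneRisk.

Theorem corollary3 (R : realType) :
  exists c : R, 0 < c /\
  forall (N : nat) (sigma : R)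
    (d : measure_display) (T : measurableType d) (P : probability T R)
    (xi : 'I_N.+1 -> {RV P >-> R}) (muQ : 'rV[R]_N.+1 -> 'rV[R]_N.+1),
  let n : R := N.+1%:R in
  (2 <= N.+1)%N -> 0 < sigma ->
  is_gaussian_noise sigma xi ->
  is_Qaggregate sigma muQ ->
  (forall mu : 'rV[R]_N.+1, monotone_cone mu ->
     ('E_P[fun w => (snorm (muQ (observation xi mu w) - mu) ^+ 2)%R] <=
      (c * Num.max ((sigma ^+ 2 * endpoint_variation mu * ln n / n) `^ (2 / 3))
                   (sigma ^+ 2 * ln n / n))%:E)%E)
  /\
  (forall (V : R) (mu : 'rV[R]_N.+1), 0 < V ->
     exists2 m : R,
       is_minimum [set snorm (u - mu) | u in monotone_cone_le V] m &
       ('E_P[fun w => snorm (muQ (observation xi mu w) - mu)] - m%:E <=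
        (c * Num.max ((sigma ^+ 2 * V * ln n / n) `^ (1 / 3))
                     (sigma * Num.sqrt (ln n / n)))%:E)%E).
Proof.
exists 1001; split; first by rewrite ltr0n.
move=> N sigma d T P xi muQ n N1 s0 Hxi HQ.
have n1 : 1 < n by rewrite ltr1n.
have n0 : 0 < n by [].
have L0 : 0 < ln n by exact: ln_gt0.
pose s := sigma * Num.sqrt (ln n / n).
have sgt0 : 0 < s by rewrite mulr_gt0// sqrtr_gt0 divr_gt0.
have ssqr : s ^+ 2 = sigma ^+ 2 * ln n / n.
  by rewrite exprMn sqr_sqrtr ?mulrA// divr_ge0// ltW.
pose t V := (sigma ^+ 2 * V * ln n / n) `^ (1 / 3).
have t0 V : 0 <= t V by exact: powR_ge0.
have x0 V : 0 <= V -> 0 <= sigma ^+ 2 * V * ln n / n.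
  move=> V0; rewrite mulr_ge0 ?invr_ge0 ?(ltW n0)// mulr_ge0 ?(ltW L0)//.
  by rewrite mulr_ge0 ?sqr_ge0.
have t3 V : 0 <= V -> t V ^+ 3 = V * (sigma ^+ 2 * ln n / n).
  move=> /x0 h; rewrite -(powR_mulrn 3 (t0 V)) /t -powRrM.
  by rewrite (_ : 1 / 3 * 3%:R = 1) ?powRr1//; [ring|field].
have M0 V : 0 < Num.max (t V) s by rewrite lt_max sgt0 orbT.
have VM V : 0 <= V -> V * (sigma ^+ 2 * ln n / n) <= Num.max (t V) s ^+ 3.
  by move=> V0; rewrite -t3// lerXn2r ?nnegrE ?le_max ?lexx ?t0.
have AM V : sigma ^+ 2 * ln n / n <= Num.max (t V) s ^+ 2.
  by rewrite -ssqr lerXn2r ?nnegrE ?le_max ?lexx ?orbT ?t0 ?(ltW sgt0).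
split.
  move=> mu hmu; set V := endpoint_variation mu.
  have V0 : 0 <= V by rewrite subr_ge0; exact: monotone_cone_ge_first.
  have [v [G [vmu mG hG IG]]] := monotone_oracle_bound s0 Hxi HQ mu N1 hmu
    (lexx V) (M0 V) (VM V V0) (AM V).
  have <- : Num.max (t V) s ^+ 2 = Num.max ((sigma ^+ 2 * V * ln n / n) `^ (2 / 3))
      (sigma ^+ 2 * ln n / n).
    rewrite -ssqr (_ : _ `^ (2 / 3) = t V ^+ 2); last first.
      by rewrite -(powR_mulrn 2 (t0 V)) /t -powRrM; congr (_ `^ _); field.
    have [h|h] := leP (t V) s.
      by rewrite max_r// lerXn2r ?nnegrE ?(ltW sgt0).
    by rewrite max_l// lerXn2r ?nnegrE ?(ltW sgt0)// ltW.
  rewrite unlock; apply: (@le_trans _ _ (\int[P]_w (G w)%:E)%E).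
    by apply: le_integral_nonmeasurable => w; rewrite lee_fin ?sqr_ge0.
  apply: le_trans IG _; rewrite lee_fin. 
  have : snorm (v - mu) ^+ 2 <= Num.max (t V) s ^+ 2.
    by rewrite lerXn2r ?nnegrE ?snorm_ge0// ltW.
  lra.
move=> V mu V0; have [u [hu uV] umin] := monotone_projection_exists mu V0.
exists (snorm (u - mu)) => //.
have [v [G [vu mG hG IG]]] := monotone_oracle_bound s0 Hxi HQ mu N1 hu
    uV (M0 V) (VM V (ltW V0)) (AM V).
set M := Num.max (t V) s in IG vu *.
have Mpos : 0 < M by exact: M0.
have IG' : (\int[P]_w (G w)%:E <= (snorm (v - mu) ^+ 2 + (32 * M) ^+ 2)%:E)%E.
  apply: le_trans IG _; rewrite lee_fin lerD2l exprMn ler_wpM2r ?sqr_ge0//.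
  by rewrite -natrX ler_nat.
have EX := expectation_le_of_square (X := fun w => snorm (muQ (observation xi mu w) - mu))
  (fun w => snorm_ge0 _) mG hG IG' (snorm_ge0 _) (mulr_gt0 (ltr0n _ 32) Mpos).
rewrite leeBlDr//; apply: le_trans EX _; rewrite -EFinD lee_fin.
have := snormD (v - u) (u - mu); rewrite addrA subrK.
lra.
Qed.
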